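(* (a) If $G$ is a quadrangulation of order $n$, then \[{\rm rad}(G) - \pi(G) \leq \frac{n+11}{8}+\frac{9}{2(n-1)}.\] (b) If $G$ is a $3$-connected quadrangulation of order $n$, then \[{\rm rad}(G)-\pi(G) \leq \frac{n+17}{12} + \frac{27}{4(n-1)}.\]
   Context: All graphs are finite, simple and connected. The order of a graph is its number of vertices. For a connected graph $G$ of order $n\ge 2$ with vertex set $V$ and shortest-path distance $d$, the average distance of a vertex $v$ is $\overline{\sigma}(v)=\frac{1}{n-1}\sum_{w\in V} d(v,w)$. The proximity of $G$ is $\pi(G)=\min_{v\in V}\overline{\sigma}(v)$. The eccentricity of $v$ is $\max_{w\in V} d(v,w)$, and the radius ${\rm rad}(G)$ is the minimum eccentricity over all vertices. A quadrangulation is a graph that is planar and bipartite, but after adding any edge is no longer planar and bipartite; quadrangulations are taken to be $2$-connected. ''$k$-connected'' refers to vertex-connectivity. *)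

(* Defs.v *)
From HB Require Import structures.
From mathcomp Require Import all_boot all_order all_algebra all_fingroup.

Set Implicit Arguments.
Unset Strict Implicit.
Unset Printing Implicit Defensive.

Import Order.TTheory GRing.Theory Num.Theory.

(** A graph is given by its adjacency relation [e] on a finite vertex type. *)

Definition simple_graph (T : finType) (e : rel T) : Prop :=
  symmetric e /\ irreflexive e.

(** * Connectivity *)

Definition connected_off (T : finType) (e : rel T) (S : {set T}) : Prop :=
  forall x y, x \notin S -> y \notin S ->
    connect [rel u v | [&& e u v, u \notin S & v \notin S]] x y.

Definition k_connected (T : finType) (k : nat) (e : rel T) : Prop :=
  k < #|T| /\ forall S : {set T}, #|S| < k -> connected_off e S.

(** * Planarity

    An embedding of a graph in an oriented closed surface is encoded, as usual
    (Heffter, Edmonds), by its rotation system: the cyclic order [rho x] in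
    which the neighbours of each vertex [x] occur around [x].  The sphere is
    singled out by the Euler characteristic, so that a graph is planar when it
    has a rotation system of genus 0. *)

Definition arcs (T : finType) (e : rel T) : {set T * T} :=
  [set a | e a.1 a.2].

(** Only the action of [rho x] on the neighbours of [x] is relevant: it is
    required to be a single cycle through all of them. *)
Definition rotation_system (T : finType) (e : rel T) (rho : T -> {perm T}) :
    Prop :=
  forall x y, e x y -> porbit (rho x) y = [set z | e x z].

(** Face tracing: having traversed the arc [(x, y)], leave [y] along the arc
    that follows [(y, x)] in the rotation at [y].  The faces are the orbits of
    this map on the arcs. *)
Definition face_step (T : finType) (rho : T -> {perm T}) (a : T * T) : T * T :=
  (a.2, rho a.2 a.1).

Definition faces (T : finType) (e : rel T) (rho : T -> {perm T}) : nat :=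
  fcard (face_step rho) (arcs e).

Definition non_isolated (T : finType) (e : rel T) : {set T} :=
  [set x | [exists y, e x y]].

(** [V - E + F = 2 C], summed over the [C] connected components having at least
    one edge, and doubled because [#|arcs e|] is [2 E].  Isolated vertices carry
    no arc and are irrelevant for planarity.  Each component contributes
    [V - E + F <= 2], so equality means that all of them have genus 0. *)
Definition planar (T : finType) (e : rel T) : Prop :=
  exists2 rho : T -> {perm T}, rotation_system e rho &
    2 * (#|non_isolated e| + faces e rho)
      = #|arcs e| + 4 * n_comp e (non_isolated e).

(** * Quadrangulations *)

Definition bipartite (T : finType) (e : rel T) : Prop :=
  exists c : T -> bool, forall x y, e x y -> c x != c y.

Definition add_edge (T : finType) (e : rel T) (u v : T) : rel T :=
  [rel x y | [|| e x y, (x == u) && (y == v) | (x == v) && (y == u)]].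

Definition quadrangulation (T : finType) (e : rel T) : Prop :=
  [/\ simple_graph e, k_connected 2 e, planar e, bipartite e
    & forall u v, u != v -> ~~ e u v ->
        ~ (planar (add_edge e u v) /\ bipartite (add_edge e u v))].

(** * Distances *)

(** The least length of a path from [x] to [y], or [#|T|] if there is none. *)
Definition dist (T : finType) (e : rel T) (x y : T) : nat :=
  find (fun k => [exists p : k.-tuple T, path e x p && (last x p == y)])
       (iota 0 #|T|).

Definition ecc (T : finType) (e : rel T) (v : T) : nat :=
  \max_(w : T) dist e v w.

Definition diameter (T : finType) (e : rel T) : nat :=
  \max_(v : T) ecc e v.

(** The default value of a minimum over all vertices is the corresponding
    maximum, and so is harmless; likewise for [proximity]. *)
Definition radius (T : finType) (e : rel T) : nat :=
  \big[minn/diameter e]_(v : T) ecc e v.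

Local Open Scope ring_scope.

Definition avg_dist (T : finType) (e : rel T) (v : T) : rat :=
  (\sum_(w : T) dist e v w)%N%:R / (#|T|%:R - 1).

Definition remoteness (T : finType) (e : rel T) : rat :=
  \big[Num.max/0]_(v : T) avg_dist e v.

Definition proximity (T : finType) (e : rel T) : rat :=
  \big[Num.min/remoteness e]_(v : T) avg_dist e v.

(* Main.v *)
Require Import Defs.
From mathcomp Require Import all_boot all_order all_algebra all_fingroup.
From mathcomp Require Import zify ring lra.

Set Implicit Arguments.
Unset Strict Implicit.
Unset Printing Implicit Defensive.

Import Order.TTheory GRing.Theory Num.Theory.

(** Let [v] be a vertex, [R] its eccentricity, [r] the radius and [n_i] the
    number of vertices at distance [i] from [v].  With [k = 2] or [3] the
    connectivity and [N = n - 1], [0 <= (N + 3k - 2kr)^2] reduces the bound to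
    [sum_i i n_i >= k r (r - 3)], which holds for every [v] because almost all
    levels [i <= r] have [n_i >= 2k], up to defects compensated by the levels
    beyond [r].

    Planarity enters only through the cohomology of the complex obtained by
    gluing a disc to every 4-cycle.  By maximality any two vertices of different
    colours on a common face are adjacent, so that face boundaries are sums of
    4-cycles, and Euler's formula together with a rank computation over [F_2]
    shows that every cocycle is a coboundary.  Hence if [n_i < 2k] then one set
    [S] of vertices of level [i] separates [v] from everything above, and [S] is
    connected by links, a link being a pair with a common neighbour below and
    one above.

    As [S] is small, a vertex [u] of level [j] well chosen below it is at
    distance at most [i - j + 2] or [i - j + 4] from all of [S].  The
    eccentricity of [u] being at least [r], this forces [R - r] to be large
    unless [i] is close to [0] or to [r]. *)

(** * Exactness from the Euler characteristic *)

Section Exactness.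

Local Open Scope ring_scope.

(** The kernel lies in the line spanned by the all-ones row. *)
Lemma ker_rank_le1 (F : fieldType) m n (M : 'M[F]_(m, n)) :
  (forall u : 'rV_m, u *m M = 0 -> forall i j, u 0 i = u 0 j) ->
  (m <= (\rank M).+1)%N.
Proof.
move=> kerM.
have: (kermx M <= (const_mx 1 : 'rV_m))%MS.
  apply/row_subP => i; have /kerM cst : row i (kermx M) *m M = 0.
    by rewrite -row_mul mulmx_ker row0.
  have m_gt0 : (0 < m)%N := leq_ltn_trans (leq0n i) (ltn_ord i).
  apply/submxP; exists (row i (kermx M) 0 (Ordinal m_gt0))%:M.
  apply/rowP => j; rewrite mul_scalar_mx !mxE mulr1.
  by have := cst j (Ordinal m_gt0); rewrite !mxE.
move/mxrankS; rewrite mxrank_ker => /leq_trans/(_ (rank_leq_row _)).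
by rewrite leq_subLR addn1.
Qed.

(* A complex  F^A --d0--> F^B --d1--> F^C  with one-dimensional end kernels is
   exact in the middle as soon as its Euler characteristic allows it *)
Lemma exact_of_euler (F : fieldType) (A B C : finType) (SB : {set B})
    (SC : {set C}) (d0 : A -> B -> F) (d1 : B -> C -> F) :
  (forall a c, c \in SC -> \sum_(b in SB) d0 a b * d1 b c = 0) ->
  (forall f : A -> F, (forall b, b \in SB -> \sum_a f a * d0 a b = 0) ->
     forall a a', f a = f a') ->
  (forall g : C -> F, (forall b, b \in SB -> \sum_(c in SC) d1 b c * g c = 0) ->
     forall c c', c \in SC -> c' \in SC -> g c = g c') ->
  (#|SB| + 2 <= #|A| + #|SC|)%N ->
  forall h : B -> F, (forall c, c \in SC -> \sum_(b in SB) h b * d1 b c = 0) ->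
  exists f : A -> F, forall b, b \in SB -> h b = \sum_a f a * d0 a b.
Proof.
move=> d01 ker0 ker1 euler h h1.
pose M0 : 'M_(#|A|, #|SB|) := \matrix_(i, j) d0 (enum_val i) (enum_val j).
pose M1 : 'M_(#|SB|, #|SC|) := \matrix_(i, j) d1 (enum_val i) (enum_val j).
have r0 : (#|A| <= (\rank M0).+1)%N.
  apply: ker_rank_le1 => u uM i j.
  pose f a := u 0 (enum_rank a).
  suff /(_ (enum_val i) (enum_val j)) : forall a a', f a = f a'.
    by rewrite /f !enum_valK.
  apply: ker0 => b bSB; move/rowP/(_ (enum_rank_in bSB b)): uM.
  rewrite !mxE => uMb; rewrite -[RHS]uMb (reindex (fun k : 'I_#|A| => enum_val k)); last first.
    by exists enum_rank => x _; rewrite ?enum_valK ?enum_rankK.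
  by apply: eq_bigr => k _; rewrite !mxE /f enum_valK enum_rankK_in.
have r1 : (#|SC| <= (\rank M1).+1)%N.
  rewrite -mxrank_tr; apply: ker_rank_le1 => u uM i j.
  pose g c := u 0 (enum_rank_in (enum_valP i) c).
  suff /(_ _ _ (enum_valP i) (enum_valP j)) :
      forall c c', c \in SC -> c' \in SC -> g c = g c'.
    by rewrite /g !enum_valK_in.
  apply: ker1 => b bSB; move/rowP/(_ (enum_rank_in bSB b)): uM.
  rewrite !mxE => uMb; rewrite -[RHS]uMb (big_enum_val (fun c => d1 b c * g c)).
  by apply: eq_bigr => k _; rewrite !mxE /g enum_valK_in enum_rankK_in // mulrC.
have M01 : M0 *m M1 = 0.
  apply/matrixP => i j; rewrite !mxE -[RHS](d01 (enum_val i) (enum_val j)).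
    rewrite (big_enum_val (fun b => d0 (enum_val i) b * d1 b (enum_val j))).
    by apply: eq_bigr => k _; rewrite !mxE.
  exact: enum_valP.
have sub01 : (M0 <= kermx M1)%MS by apply/sub_kermxP.
(* The kernel of [M1] has dimension at most [#|SB| + 1 - #|SC|], hence at most [#|A| - 1], hence at
   most the rank of [M0]. *)
have sub10 : (kermx M1 <= M0)%MS.
  rewrite -(geq_leqif (mxrank_leqif_sup sub01)) mxrank_ker; lia.
pose u : 'rV_(#|SB|) := \row_j h (enum_val j).
have /submxP[w wE] : (u <= M0)%MS.
  apply: submx_trans sub10; apply/sub_kermxP/rowP => j.
  rewrite !mxE -[RHS](h1 (enum_val j)) ?enum_valP //.
  rewrite (big_enum_val (fun b => h b * d1 b (enum_val j))).
  by apply: eq_bigr => k _; rewrite !mxE.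
exists (fun a => w 0 (enum_rank a)) => b bSB.
move/rowP/(_ (enum_rank_in bSB b)): wE; rewrite !mxE enum_rankK_in // => ->.
rewrite (reindex (@enum_rank A)); last first.
  by exists enum_val => x _; rewrite ?enum_valK ?enum_rankK.
by apply: eq_bigr => a _; rewrite !mxE enum_rankK enum_rankK_in.
Qed.

End Exactness.

(** * Inserting an edge in a face *)

Section PermutationOrbits.

Variable D : finType.
Implicit Types (s t : {perm D}) (A : {set D}).

Lemma fconnect_porbit s x y : fconnect s x y = (y \in porbit s x).
Proof.
apply/idP/porbitP => [/iter_findex <-|[k ->]].
  by exists (findex s x y); rewrite permX.
by rewrite permX fconnect_iter.
Qed.

Lemma porbit_step s x y : (s y \in porbit s x) = (y \in porbit s x).
Proof. by rewrite -!fconnect_porbit -same_fconnect1_r //; apply: perm_inj. Qed.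

Lemma fcard_porbit s A : (forall x, (s x \in A) = (x \in A)) ->
  fcard s A = #|porbit s @: A|.
Proof.
move=> clA; have sym := fconnect_sym (@perm_inj _ s).
have clA' : closed (frel s) A by move=> x _ /eqP <-; rewrite clA.
have -> : porbit s @: A = porbit s @: [set x in A | froots s x].
  apply/setP => B; apply/imsetP/imsetP => [[x xA ->]|[x]]; last first.
    by rewrite inE => /andP[xA _] ->; exists x.
  have cx := connect_root (frel s) x.
  exists (froot s x).
    by rewrite inE -(closed_connect clA' cx) xA (roots_root sym).
  by apply/eqP; rewrite eq_porbit_mem -fconnect_porbit sym.
rewrite card_in_imset; last first.
  move=> x y; rewrite !inE => /andP[_ /eqP rx] /andP[_ /eqP ry] /eqP.
  by rewrite eq_porbit_mem -fconnect_porbit -(root_connect sym) rx ry => /eqP.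
by apply: eq_card => x; rewrite !inE andbC.
Qed.

Lemma eq_porbit_in s t A x : (forall y, y \in A -> s y = t y) ->
  (forall y, y \in A -> s y \in A) -> x \in A -> porbit s x = porbit t x.
Proof.
move=> st clA xA.
have itA k : iter k s x = iter k t x /\ iter k s x \in A.
  by elim: k => //= k [<- kA]; rewrite -st ?clA.
apply/setP => y; apply/porbitP/porbitP => -[k ->]; exists k;
  by rewrite !permX (itA k).1.
Qed.

(* Multiplying by [tperm a b] splices the orbit of [b] into that of [a] *)
Lemma porbit_splice s a b x : b \notin porbit s a -> x \in porbit s a ->
  x \in porbit (tperm a b * s) (s b).
Proof.
move=> bNa /porbitP[k ->]; set t := (_ * s)%g.
have ta : t a = s b by rewrite permM tpermL.
have tb : t b = s a by rewrite permM tpermR.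
have bs : b \in porbit t (s b).
  have [m mE] : exists m, iter m s (s b) = b.
    by exists (findex s (s b) b); rewrite iter_findex // fconnect_porbit
      porbit_sym porbit_step porbit_id.
  suff /(_ m (leqnn m)) : forall n, n <= m -> iter n s (s b) \in porbit t (s b).
    by rewrite mE.
  elim=> [|n IHn] le_nm; first exact: porbit_id.
  have nb : iter n s (s b) \in porbit t (s b) by apply: IHn; lia.
  case: (altP (iter n s (s b) =P b)) => [nE|nNb].
    by rewrite /= nE porbit_id.
  rewrite iterS; have <- : t (iter n s (s b)) = s (iter n s (s b)).
    rewrite permM tpermD // 1?eq_sym //.
    apply: contraNneq bNa => <-; rewrite -iterSr -permX.
    by rewrite porbit_sym mem_porbit.
  by rewrite porbit_step.
rewrite permX; elim: k => [|k IHk] /=.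
  by rewrite -porbit_step ta porbit_id.
case: (altP (iter k s a =P a)) => [->|kNa].
  by rewrite -tb porbit_step.
have <- : t (iter k s a) = s (iter k s a).
  rewrite permM tpermD // 1?eq_sym //.
  by apply: contraNneq bNa => <-; rewrite -permX mem_porbit.
by rewrite porbit_step.
Qed.

(** The product sends [a] to [b] and [b] to [s a]: the fixed point [b] is inserted just after
    [a]. *)
Lemma porbit_insert s a b : s b = b -> b \notin porbit s a ->
  porbit (tperm a b * s) b = b |: porbit s a.
Proof.
move=> sb bNa; apply/eqP; rewrite eqEsubset; apply/andP; split; last first.
  rewrite subUset sub1set porbit_id; apply/subsetP => x.
  by move/(porbit_splice bNa); rewrite sb.
apply/subsetP => _ /porbitP[k ->]; rewrite permX.
elim: k => [|k]; first by rewrite !inE eqxx.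
rewrite iterS !inE permM; case: tpermP => [-> _|-> _|_ kNb].
- by rewrite sb eqxx.
- by rewrite porbit_step porbit_id orbT.
- by case/predU1P=> [/kNb|kin]; rewrite ?porbit_step ?kin ?orbT.
Qed.

End PermutationOrbits.

Section Rotations.

Variable T : finType.
Implicit Types (e : rel T) (rho : T -> {perm T}).

Lemma face_step_inj rho : injective (face_step rho).
Proof. by move=> [a b] [c d] [] -> /perm_inj ->. Qed.

Definition face_perm rho : {perm T * T} := perm (@face_step_inj rho).

Lemma face_permE rho a : face_perm rho a = (a.2, rho a.2 a.1).
Proof. by rewrite permE. Qed.

Lemma rotation_closed e rho : rotation_system e rho ->
  forall x y, e x (rho x y) = e x y.
Proof.
move=> rot x y; apply/idP/idP => exy; move: (rot _ _ exy) => /setP oE.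
  by have:= oE y; rewrite inE => <-; rewrite porbit_sym porbit_step porbit_id.
by have:= oE (rho x y); rewrite inE => <-; rewrite porbit_step porbit_id.
Qed.

Lemma arcs_closed e rho : symmetric e -> rotation_system e rho ->
  forall a, (face_perm rho a \in arcs e) = (a \in arcs e).
Proof.
by move=> sym rot a; rewrite !inE face_permE /= (rotation_closed rot) sym.
Qed.

Lemma eq_faces e rho rho' : symmetric e -> rotation_system e rho ->
  (forall x y, e x y -> rho x y = rho' x y) -> rotation_system e rho' ->
  faces e rho = faces e rho'.
Proof.
move=> sym rot E rot'; rewrite /faces.
have H r : fcard (face_step r) (arcs e) = fcard (face_perm r) (arcs e).
  by apply: eq_n_comp => x y; apply: eq_fconnect => z; rewrite permE.
rewrite !H !fcard_porbit; try exact: arcs_closed.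
congr #|pred_of_set _|; apply: eq_in_imset => a aA.
apply: (eq_porbit_in (A := arcs e)) => // b; last by rewrite arcs_closed.
by rewrite inE !face_permE => ?; rewrite E // sym.
Qed.

Lemma facesE e rho : symmetric e -> rotation_system e rho ->
  faces e rho = fcard (face_perm rho) (arcs e).
Proof.
by move=> sym rot; apply: eq_n_comp => x y; apply: eq_fconnect => z; rewrite permE.
Qed.

(** Once [rho x] fixes all non-neighbours of [x], a new neighbour is a fixed point that
    [porbit_insert] can splice in. *)
Lemma normal_rotation e rho : symmetric e -> rotation_system e rho ->
  exists rho', [/\ rotation_system e rho', faces e rho' = faces e rho
    & forall x y, ~~ e x y -> rho' x y = y].
Proof.
move=> sym rot.
have inj x : injective (fun y => if e x y then rho x y else y).
  move=> y z; case: ifPn => xy; case: ifPn => xz //.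
  - exact: perm_inj.
  - by move=> E; rewrite -E (rotation_closed rot) xy in xz.
  - by move=> E; rewrite E (rotation_closed rot) xz in xy.
pose rho' x := perm (inj x).
have E x y : e x y -> rho x y = rho' x y by move=> xy; rewrite permE xy.
have rot' : rotation_system e rho'.
  move=> x y xy; rewrite -(rot x y xy); symmetry.
  apply: (eq_porbit_in (A := [set z | e x z])); rewrite ?inE // => z;
    by rewrite !inE ?(rotation_closed rot) //; apply: E.
exists rho'; split=> //; first by symmetry; apply: eq_faces.
by move=> x y xy; rewrite permE (negPf xy).
Qed.

Section InsertEdge.

Variables (e : rel T) (rho : T -> {perm T}) (p q : T * T).
Hypothesis sym : symmetric e.
Hypothesis rot : rotation_system e rho.
Hypothesis nrm : forall x y, ~~ e x y -> rho x y = y.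
Hypothesis arc_p : p \in arcs e.
Hypothesis arc_q : q \in arcs e.
Hypothesis neq_xy : p.2 != q.2.
Hypothesis non_edge : ~~ e p.2 q.2.
Hypothesis same_face : p \in porbit (face_perm rho) q.

Let x := p.2.
Let y := q.2.
Let e' := add_edge e x y.

(** The new edge is drawn inside the common face of [p] and [q]: at [x] it comes right after [p.1],
    in the corner that the face turns through on arriving along [p], and similarly at [y]. *)
Definition insert_rotation (z : T) : {perm T} :=
  if z == x then (tperm p.1 y * rho x)%g
  else if z == y then (tperm q.1 x * rho y)%g else rho z.

Lemma add_edge_sym : symmetric e'.
Proof.
move=> a b; rewrite /e' /add_edge /= sym; congr orb.
by rewrite orbC; congr orb; apply: andbC.
Qed.

Lemma porbit_insert_neighbour z a b w : e z a -> ~~ e z b ->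
  e z w || (w == b) -> porbit (tperm a b * rho z) w = [set c | e z c || (c == b)].
Proof.
move=> za zb zw; have E := rot za.
have bNa : b \notin porbit (rho z) a by rewrite E inE.
have -> : [set c | e z c || (c == b)] = b |: porbit (rho z) a.
  by apply/setP => c; rewrite E !inE orbC.
rewrite -porbit_insert ?nrm //; apply/eqP; rewrite eq_porbit_mem.
by rewrite porbit_insert ?nrm // E !inE orbC.
Qed.

Lemma insert_rotation_system : rotation_system e' insert_rotation.
Proof.
move=> z w; rewrite /insert_rotation /e' /add_edge /=.
have xy : (x == y) = false := negPf neq_xy.
have nyx : ~~ e y x by rewrite sym.
have ex : e x p.1 by rewrite sym; move: arc_p; rewrite inE.
have ey : e y q.1 by rewrite sym; move: arc_q; rewrite inE.
have [->|zx] := eqVneq z x.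
  rewrite xy orbF /= => xw; rewrite porbit_insert_neighbour //.
  by apply/setP => c; rewrite !inE orbF.
have [->|zy] := eqVneq z y.
  by rewrite /= => yw; rewrite porbit_insert_neighbour //.
by rewrite /= orbF => /rot ->; apply/setP => c; rewrite !inE /= orbF.
Qed.

Lemma tperm_pair (a b c u v : T) :
  tperm (a, c) (b, c) (u, v) = if v == c then (tperm a b u, c) else (u, v).
Proof.
case: eqP => [->|vc]; last first.
  by rewrite tpermD //; apply/eqP => -[_ /esym].
case: (tpermP a b u) => [->|->|ua ub]; rewrite ?tpermL ?tpermR //.
by rewrite tpermD //; apply/eqP => -[/esym].
Qed.

Lemma insert_face_perm :
  face_perm insert_rotation
    = (tperm p (y, x) * (tperm q (x, y) * face_perm rho))%g.
Proof.
apply/permP => -[a b]; rewrite !permM !face_permE /insert_rotation /=.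
have [pE qE] : p = (p.1, x) /\ q = (q.1, y) by rewrite /x /y; case: (p); case: (q).
rewrite pE qE !tperm_pair /=.
have xy : (x == y) = false := negPf neq_xy.
have [->|bx] := eqVneq b x; first by rewrite tperm_pair xy /= permM.
rewrite tperm_pair; have [->|//] := eqVneq b y; by rewrite permM.
Qed.

(** Under [s] the pairs [(x, y)] and [(y, x)] form an orbit of their own. The transposition with [q]
    merges it into the face of [q]; the one with [p] then splits the result, as [p] lies on that
    face too. *)
Lemma card_porbits_insert :
  #|porbits (face_perm insert_rotation)| = #|porbits (face_perm rho)|.
Proof.
set s := face_perm rho; rewrite insert_face_perm -/s.
have xyN : (x, y) \notin arcs e by rewrite inE.
have yxN : (y, x) \notin arcs e by rewrite inE /= sym.
have clA := arcs_closed sym rot.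
have sq_arcs z : z \in porbit s q -> z \in arcs e.
  by move/porbitP => [k ->]; rewrite permX; elim: k => //= k; rewrite clA.
have xyNq : (x, y) \notin porbit s q by apply: contra xyN => /sq_arcs.
have sxy : s (x, y) = (y, x) by rewrite face_permE /= nrm // sym.
have:= porbits_mul_tperm s q (x, y).
have:= porbits_mul_tperm (tperm q (x, y) * s)%g p (y, x).
rewrite /= -sxy porbit_splice // porbit_sym (negPf xyNq) /=.
have -> : p != s (x, y) by apply: contraNneq yxN => pE; rewrite -sxy -pE.
have -> : q != (x, y) by apply: contraNneq xyN => <-.
by rewrite -[0.*2]/0 -[1.*2]/2 -[nat_of_bool true]/1 addn0 addn2 !addn1 => -> [].
Qed.

(** The total number of orbits is unchanged, but the orbit of [(x, y)] and [(y, x)] no longer counts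
    among the non-arcs, and the other non-arcs are permuted as before. *)
Lemma faces_insert : faces e' insert_rotation = (faces e rho).+1.
Proof.
have rot' := insert_rotation_system.
rewrite (facesE sym rot) (facesE add_edge_sym rot').
set s := face_perm rho; set s' := face_perm _.
have clA := arcs_closed sym rot; have clA' := arcs_closed add_edge_sym rot'.
have cardT t : #|porbits t| = fcard t [set: T * T].
  rewrite fcard_porbit => [|u]; last by rewrite !inE.
  congr #|pred_of_set _|; apply/setP => B.
  by apply/imsetP/imsetP => -[u _ ->]; exists u; rewrite ?inE.
have splitC t (B : {set T * T}) : #|porbits t| = (fcard t B + fcard t (~: B))%N.
  rewrite cardT (eq_n_comp_r (a' := xpredT)) => [|u]; last by rewrite !inE.
  rewrite (n_compC B); congr (_ + _)%N; apply: eq_n_comp_r => u.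
  by rewrite !inE.
have := splitC s (arcs e); have := splitC s' (arcs e').
rewrite [#|porbits s'|]card_porbits_insert -/s.
have out_xy : (x, y) \notin arcs e by rewrite inE.
have out_yx : (y, x) \notin arcs e by rewrite inE /= sym.
have arcsE u : (u \in arcs e') = [|| u \in arcs e, u == (x, y) | u == (y, x)].
  by rewrite !inE; case: u => a b; rewrite /= !xpair_eqE.
have cE u : (u \in ~: arcs e)
    = (u \in [set (x, y); (y, x)]) || (u \in ~: arcs e').
  rewrite !in_setC arcsE in_set2.
  have [->|_] := eqVneq u (x, y); first by rewrite out_xy.
  by have [->|_] := eqVneq u (y, x); rewrite ?orbF //= out_yx.
have sxy : s (x, y) = (y, x) by rewrite face_permE /= nrm // sym.
have syx : s (y, x) = (x, y) by rewrite face_permE /= nrm.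
have -> : fcard s (~: arcs e)
    = (fcard s [set (x, y); (y, x)] + fcard s (~: arcs e'))%N.
  rewrite /n_comp_mem -cardUI [X in _ = (_ + X)%N]eq_card0 ?addn0 => [|u].
    apply: eq_card => u; rewrite inE [RHS]inE /=.
    by rewrite ![u \in predI _ _]inE /= -andb_orr -cE.
  rewrite ![u \in predI _ _]inE /=.
  apply: negbTE; apply/negP => /andP[/andP[_ ]]; rewrite in_set2 => uxy.
  by case/andP=> _; rewrite in_setC arcsE uxy orbT.
have -> : fcard s [set (x, y); (y, x)] = 1%N.
  rewrite fcard_porbit ?imsetU1 ?imset_set1 => [|u].
    have -> : porbit s (x, y) = porbit s (y, x).
      by apply/eqP; rewrite eq_porbit_mem -porbit_step sxy porbit_id.
    by rewrite setUid cards1.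
  rewrite !inE -{1}sxy -{1}syx !(inj_eq perm_inj) orbC.
  by [].
suff -> : fcard s (~: arcs e') = fcard s' (~: arcs e') by lia.
have clC' a : (s' a \in ~: arcs e') = (a \in ~: arcs e') by rewrite !in_setC clA'.
have st a : a \in ~: arcs e' -> s a = s' a.
  rewrite in_setC arcsE => /norP[aA /norP[axy ayx]].
  rewrite /s' insert_face_perm !permM [tperm p _ a]tpermD 1?eq_sym //; last first.
    by apply: contraNneq aA => ->.
  by rewrite tpermD 1?eq_sym //; apply: contraNneq aA => ->.
have clC a : (s a \in ~: arcs e') = (a \in ~: arcs e').
  apply/idP/idP => [|aC]; last by rewrite st // clC'.
  rewrite !in_setC; apply: contra; rewrite !arcsE => /or3P[aA|/eqP->|/eqP->].
  - by rewrite clA aA.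
  - by rewrite sxy eqxx !orbT.
  - by rewrite syx eqxx !orbT.
rewrite !fcard_porbit //; congr #|pred_of_set _|; apply: eq_in_imset => a aA.
by apply: (eq_porbit_in (A := ~: arcs e')) => // b; rewrite clC.
Qed.

End InsertEdge.
End Rotations.

(** * Cocycles of quadrangulations *)

Section Quadrangulations.

Variable T : finType.
Implicit Types (e : rel T) (rho : T -> {perm T}).

Lemma k_connected_connect k e : 0 < k -> k_connected k e ->
  forall x y, connect e x y.
Proof.
move=> k_gt0 [_ /(_ set0)]; rewrite cards0 => /(_ k_gt0) con x y.
have:= con x y; rewrite !inE => /(_ isT isT).
by apply: connect_sub => u v /and3P[uv _ _]; apply: connect1.
Qed.

Lemma connected_euler e rho : symmetric e -> 1 < #|T| ->
  (forall x y, connect e x y) ->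
  2 * (#|non_isolated e| + faces e rho)
    = #|arcs e| + 4 * n_comp e (non_isolated e)
  <-> 2 * (#|T| + faces e rho) = #|arcs e| + 4.
Proof.
move=> sym T_gt1 con.
have niT : non_isolated e =i xpredT.
  move=> x; rewrite inE; apply/existsP.
  have /card_gt0P[y] : 0 < #|predC1 x| by rewrite cardC1; lia.
  rewrite inE => yx; case/connectP: (con x y) => -[/= _ yE|z p /andP[xz _] _].
    by rewrite yE eqxx in yx.
  by exists z.
have -> : #|non_isolated e| = #|T| by apply: eq_card => x; rewrite niT.
have [x _] : exists x : T, true by move/ltnW/card_gt0P: T_gt1 => [x]; exists x.
have -> : n_comp e (non_isolated e) = 1; last by rewrite muln1.
rewrite -(n_comp_connect (sym_connect_sym sym) x).
by apply: eq_n_comp_r => y; rewrite niT [RHS]con.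
Qed.

Lemma card_arcs_add_edge e x y : symmetric e -> x != y -> ~~ e x y ->
  #|arcs (add_edge e x y)| = #|arcs e| + 2.
Proof.
move=> sym xy nxy.
have -> : arcs (add_edge e x y) = (x, y) |: ((y, x) |: arcs e).
  apply/setP => -[a b]; rewrite !inE /= !xpair_eqE.
  by rewrite orbA orbC.
rewrite !cardsU1 !inE /= xpair_eqE (negPf xy) /= nxy sym nxy /=; lia.
Qed.

(** Drawing the missing edge inside the face would add one edge and one face, preserving Euler's
    formula and the colouring, against maximality. *)
Lemma same_face_adjacent e rho p q : quadrangulation e ->
  rotation_system e rho -> (forall x y, ~~ e x y -> rho x y = y) ->
  2 * (#|T| + faces e rho) = #|arcs e| + 4 ->
  (exists2 c : T -> bool, forall x y, e x y -> c x != c y & c p.2 != c q.2) ->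
  p \in arcs e -> q \in arcs e -> p \in porbit (face_perm rho) q -> e p.2 q.2.
Proof.
move=> [[sym irr] con2 _ _ maxl] rot nrm euler [c cP cpq] pA qA pq.
apply: contraT => npq.
have neq : p.2 != q.2 by apply: contraNneq cpq => ->.
have con := k_connected_connect (isT : 0 < 2) con2.
case: (maxl _ _ neq npq); split; last first.
  exists c => x y /or3P[/cP //|/andP[/eqP-> /eqP->] //|/andP[/eqP-> /eqP->]].
  by rewrite eq_sym.
exists (insert_rotation rho p q); first exact: insert_rotation_system.
apply/connected_euler.
- exact: add_edge_sym.
- by apply: leq_trans con2.1.
- by move=> x y; apply: connect_sub (con x y) => u v uv; apply/connect1/orP; left.
- rewrite faces_insert // card_arcs_add_edge //; lia.
Qed.

Local Open Scope ring_scope.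

Lemma F2_addrr (x : 'F_2) : x + x = 0.
Proof. by rewrite -mulr2n -mulr_natr pchar_Zp // mulr0. Qed.

Lemma F2_eq (x y : 'F_2) : x + y = 0 -> x = y.
Proof. by move=> xy; rewrite -[LHS]addr0 -(F2_addrr y) addrA xy add0r. Qed.

End Quadrangulations.

Section Cocycles.

Variable T : finType.
Variable e : rel T.
Hypothesis sym : symmetric e.

Local Open Scope ring_scope.

(** A 1-cocycle over ['F_2] of the complex with a disc glued to every 4-cycle. Degenerate closed
    walks impose nothing, by the symmetry of [h]. *)
Definition square_cocycle (h : T -> T -> 'F_2) : Prop :=
  (forall x y, h x y = h y x) /\
  (forall a b c d, e a b -> e b c -> e c d -> e d a ->
     h a b + h b c + h c d + h d a = 0).

(* All chords [v 0 -- v n], [n] odd, of the face [v] are edges, and they cut it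
   into 4-cycles *)
Lemma face_sum (rho : T -> {perm T}) (h : T -> T -> 'F_2) (c : T -> bool) p :
  rotation_system e rho -> square_cocycle h ->
  (forall x y, e x y -> c x != c y) -> p \in arcs e ->
  (forall q, q \in porbit (face_perm rho) p -> c p.2 != c q.2 -> e p.2 q.2) ->
  \sum_(a in porbit (face_perm rho) p) h a.1 a.2 = 0.
Proof.
move=> rot [hsym hsq] cP pA adj.
set s := face_perm rho; set m := #|porbit s p|.
pose v t := (iter t s p).2.
have arcI t : iter t s p \in arcs e.
  by elim: t => //= t; rewrite arcs_closed.
have fstS t : (iter t.+1 s p).1 = v t by rewrite iterS face_permE.
have ev t : e (v t) (v t.+1) by have := arcI t.+1; rewrite inE fstS.
have cv t : c (v t) = c (v 0%N) (+) odd t.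
  elim: t => [|t IHt]; first by rewrite addbF.
  by have := cP _ _ (ev t); rewrite IHt /=; case: (c (v t.+1)) (c (v 0%N)) (odd t) => [] [] [].
have adjv t : odd t -> e (v 0%N) (v t).
  move=> ot; apply: adj; first by rewrite -permX mem_porbit.
  by rewrite -/(v 0%N) -/(v t) (cv t) ot; case: (c _).
have vm : v m = v 0%N by rewrite /v /m iter_porbit.
have [m' mE] : exists m', m = m'.+1.
  by exists m.-1; rewrite prednK // lt0n card_porbit_neq0.
(* Colours alternate along the face, so its length [m] is even. *)
have om' : odd m'.
  by have := cv m; rewrite vm mE /=; case: (c _) (odd m') => [] [].
have -> : \sum_(a in porbit s p) h a.1 a.2
    = \sum_(t < m) h (iter t s p).1 (iter t s p).2.
  rewrite (eq_bigl (mem (traject s p m))) => [|a]; last exact: porbit_traject.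
  rewrite -big_uniq ?uniq_traject_porbit // (big_nth p) size_traject big_mkord.
  by apply: eq_bigr => t _; rewrite nth_traject.
rewrite mE big_ord_recl /= addrC.
have -> : h p.1 p.2 = h (v m') (v 0%N).
  by rewrite -fstS -mE /m iter_porbit.
rewrite (eq_bigr (fun t : 'I_m' => h (v t) (v t.+1))) => [|t _]; last first.
  by rewrite /bump /= -fstS.
have chord k : \sum_(t < k.*2.+1) h (v t) (v t.+1) = h (v 0%N) (v k.*2.+1).
  elim: k => [|k IHk]; first by rewrite big_ord1.
  rewrite doubleS !big_ord_recr /= in IHk *; rewrite IHk.
  have := hsq (v 0%N) (v k.*2.+1) (v k.*2.+2) (v k.*2.+3).
  rewrite !ev ![e _ (v 0%N)]sym !adjv /= ?odd_double // => /(_ isT isT isT isT).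
  by move/F2_eq; rewrite [h _ (v 0%N)]hsym.
by rewrite -(odd_double_half m') om' add1n chord hsym F2_addrr.
Qed.

End Cocycles.

Section Coboundary.

Variable T : finType.
Variable e : rel T.
Hypothesis quad : quadrangulation e.

Local Open Scope ring_scope.

(** This is [exact_of_euler] for the cochains of the embedding, on vertices, edges and faces. *)
Lemma square_cocycle_coboundary h : square_cocycle e h ->
  exists f : T -> 'F_2, forall x y, e x y -> h x y = f x + f y.
Proof.
have [[sym irr] con2 [rho0 rot0 euler0] [c cP] _] := quad.
have con := k_connected_connect (isT : (0 < 2)%N) con2.
have T_gt1 : (1 < #|T|)%N by apply: leq_trans con2.1.
have [rho [rot facesE0 nrm]] := normal_rotation sym rot0.
move/(connected_euler rho0 sym T_gt1 con): euler0; rewrite -facesE0 => euler.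
move=> hcoc; have [hsym hsq] := hcoc.
set s := face_perm rho.
pose root a := froot s a.
pose rev (a : T * T) := (a.2, a.1).
have sI : injective s by apply: perm_inj.
have symf := fconnect_sym sI.
have clA := arcs_closed sym rot.
have rootA a : (root a \in arcs e) = (a \in arcs e).
  have cl : closed (frel s) (arcs e) by move=> x _ /eqP <-; rewrite clA.
  by rewrite -(closed_connect cl (connect_root _ a)).
have root_s a : root (s a) = root a.
  by apply/eqP; rewrite root_connect // symf fconnect1.
have revA a : (rev a \in arcs e) = (a \in arcs e) by rewrite !inE sym.
have revK : involutive rev by case.
(* One arc per edge, the one leaving the endpoint of colour [false], and one root arc per face. *)
pose EB := [set a in arcs e | ~~ c a.1].
pose FS := [set a in arcs e | root a == a].
have sum_arcs (F : T * T -> 'F_2) :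
    \sum_(a in arcs e) F a = \sum_(a in EB) (F a + F (rev a)).
  rewrite (bigID (fun a => ~~ c a.1)) /= big_split /=; congr (_ + _).
    by apply: eq_bigl => a; rewrite !inE.
  rewrite (reindex_inj (inv_inj revK)); apply: eq_bigl => a.
  rewrite revA !inE; case: (boolP (e _ _)) => // /cP.
  by case: (c _) (c _) => [] [].
have card_arcs : #|arcs e| = (2 * #|EB|)%N.
  rewrite -!sum1_card (bigID (fun a => ~~ c a.1)) /= mul2n -addnn.
  congr (_ + _)%N; first by apply: eq_bigl => a; rewrite !inE.
  rewrite (reindex_inj (inv_inj revK)); apply: eq_bigl => a.
  rewrite revA !inE; case: (boolP (e _ _)) => // /cP.
  by case: (c _) (c _) => [] [].
have pick1 (I : finType) (P : pred I) (F : I -> 'F_2) i : P i ->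
    \sum_(j | P j) (i == j)%:R * F j = F i.
  move=> Pi; rewrite (bigD1 i) //= eqxx mul1r big1 ?addr0 // => j /andP[_].
  by rewrite eq_sym => /negPf->; rewrite mul0r.
pose d0 x (a : T * T) : 'F_2 := (a.1 == x)%:R + (a.2 == x)%:R.
pose d1 (a b : T * T) : 'F_2 := (root a == b)%:R + (root (rev a) == b)%:R.
have d0E f a : \sum_x f x * d0 x a = f a.1 + f a.2.
  rewrite (eq_bigr (fun x => (a.1 == x)%:R * f x + (a.2 == x)%:R * f x)).
    by rewrite big_split /= !pick1.
  by move=> x _; rewrite mulrDr ![f x * _]mulrC.
have rootFS a : a \in arcs e -> root a \in FS.
  by move=> aA; rewrite inE rootA aA /root (root_root symf) /=.
have d1E (g : T * T -> 'F_2) a : a \in arcs e ->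
    \sum_(b in FS) d1 a b * g b = g (root a) + g (root (rev a)).
  move=> aA; under eq_bigr do rewrite mulrDl.
  by rewrite big_split /= !pick1 // rootFS // revA.
have edgeE x y : e x y -> (x, y) \in EB \/ (y, x) \in EB.
  move=> xy; rewrite !inE /= [e y x]sym xy /=; move/cP: xy.
  by case: (c x) (c y) => [] [] //; [right|left].
have const (g : T -> 'F_2) : (forall x y, e x y -> g x = g y) -> forall x y, g x = g y.
  move=> gE x y; case/connectP: (con x y) => p; elim: p x => [x _ ->|z p IHp x] //=.
  by case/andP => /gE -> /IHp; apply.
have [|||||f fP] := @exact_of_euler _ _ _ _ EB FS d0 d1 _ _ _ _ (fun a => h a.1 a.2) _.
(* A face boundary arrives at [x] as often as it leaves, as reindexing along the face permutation
   shows. *)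
- move=> x r rFS.
  pose G a : 'F_2 := d0 x a * (root a == r)%:R.
  have -> : \sum_(b in EB) d0 x b * d1 b r = \sum_(a in arcs e) G a.
    rewrite sum_arcs; apply: eq_bigr => b _; rewrite /G mulrDr; congr (_ + _).
    by congr (_ * _); rewrite /d0 addrC.
  under eq_bigr do rewrite /G mulrDl.
  rewrite big_split /= [X in X + _](reindex_inj sI) /=.
  rewrite (eq_bigl (mem (arcs e))) => [|a]; last by rewrite clA.
  rewrite [X in X + _](eq_bigr (fun a => (a.2 == x)%:R * (root a == r)%:R)).
    exact: F2_addrr.
  by move=> a _; rewrite root_s face_permE.
- move=> f fE; apply: const => x y /edgeE[] /fE; rewrite d0E /= => /F2_eq //.
(* Such a [g] agrees on the two sides of each edge, hence on all faces around a vertex, hence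
   everywhere by connectedness. *)
- move=> g gE.
  have gr a : a \in arcs e -> g (root a) = g (root (rev a)).
    case: a => x y; rewrite inE => /edgeE[] E; move: (gE _ E);
    by rewrite d1E; [move/F2_eq | move: E; rewrite inE => /andP[]].
  have gs x y z : e x y -> e x z -> g (root (x, y)) = g (root (x, z)).
    move=> xy; have := rot x y xy => /setP/(_ z); rewrite inE => <-.
    case/porbitP => k ->; rewrite permX.
    suff [] : e x (iter k (rho x) y) /\
        g (root (x, y)) = g (root (x, iter k (rho x) y)) by [].
    elim: k => [|k [xw ->]] //=; set w := iter k _ _ in xw *.
    split; first by rewrite (rotation_closed rot).
    by rewrite gr ?inE // -[in RHS](face_permE rho (w, x)) root_s.
  pose gv x := if [pick y | e x y] is Some y then g (root (x, y)) else 0.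
  have gvE x y : e x y -> gv x = g (root (x, y)).
    move=> xy; rewrite /gv; case: pickP => [z xz|/(_ y)]; last by rewrite xy.
    exact: gs.
  have gvc : forall x y, gv x = gv y.
    apply: const => x y xy; rewrite (gvE x y xy) (gvE y x) 1?sym //.
    by rewrite gr ?inE.
  move=> [x y] [x' y']; rewrite !inE /= => /andP[xy /eqP rxy] /andP[xy' /eqP rxy'].
  by rewrite -rxy -rxy' -!gvE.
- have := facesE sym rot; have -> : fcard s (arcs e) = #|FS|.
    by apply: eq_card => a; rewrite [RHS]inE inE /= andbC.
  by move=> FE; move: euler; rewrite FE card_arcs; lia.
(* Along each face [h] sums to zero by [face_sum], whose chords come from [same_face_adjacent]. *)
- move=> r rFS; have [rA /eqP rr] : r \in arcs e /\ root r == r.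
    by move: rFS; rewrite inE => /andP[].
  have -> : \sum_(b in EB) h b.1 b.2 * d1 b r = \sum_(a in porbit s r) h a.1 a.2.
    transitivity (\sum_(a in arcs e) h a.1 a.2 * (root a == r)%:R).
      rewrite sum_arcs; apply: eq_bigr => b _; rewrite mulrDr; congr (_ + _).
      by rewrite hsym.
    rewrite big_mkcond [RHS]big_mkcond; apply: eq_bigr => a _.
    rewrite -fconnect_porbit -(root_connect symf) -/(root r) rr eq_sym.
    have [rE|_] := eqVneq r (froot s a); last by rewrite mulr0 if_same.
    by rewrite mulr1 -rootA /root -rE rA.
  apply: (face_sum sym rot hcoc cP rA) => q qr cq.
  have qA : q \in arcs e.
    by case/porbitP: qr => k ->; rewrite permX; elim: k => //= k; rewrite clA.
  apply: (same_face_adjacent quad rot nrm euler) => //; first by exists c.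
  by rewrite porbit_sym.
exists f => x y /edgeE[] /fP; rewrite d0E //= => E.
by rewrite hsym E addrC.
Qed.

End Coboundary.

(** * Distances and levels *)

Section Distance.

Variable T : finType.
Variable e : rel T.
Hypothesis sym : symmetric e.
Hypothesis con : forall x y, connect e x y.

Notation d := (dist e).

Lemma dist_path x p : path e x p -> d x (last x p) <= size p.
Proof.
move=> xp; rewrite leqNgt; apply/negP => lt_pd.
have lt_pT : size p < #|T|.
  by apply: leq_trans lt_pd _; rewrite -[leqRHS](size_iota 0) find_size.
have := before_find 0 lt_pd; rewrite nth_iota // add0n => /existsP[].
by exists (in_tuple p); rewrite /= xp eqxx.
Qed.

Lemma dist_witness x y :
  exists p, [/\ path e x p, last x p = y & size p = d x y].
Proof.
case/connectP: (con x y) => q xq yE.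
case/shortenP: xq yE => p xp up _ yE.
have lt_pT : size p < #|T|.
  by have := uniq_leq_size up (fun z _ => mem_enum T z); rewrite -cardE.
have hasP : has (fun k => [exists p : k.-tuple T, path e x p && (last x p == y)])
    (iota 0 #|T|).
  apply/hasP; exists (size p); first by rewrite mem_iota.
  by apply/existsP; exists (in_tuple p); rewrite xp yE /=.
have := nth_find 0 hasP; rewrite nth_iota; last by rewrite -[ltnRHS](size_iota 0) -has_find.
case/existsP => r /andP[xr /eqP rE]; exists r; split=> //.
by rewrite size_tuple.
Qed.

Lemma distxx x : d x x = 0.
Proof. by apply/eqP; rewrite -leqn0; apply: (@dist_path x [::]). Qed.

Lemma dist_triangle y x z : d x z <= d x y + d y z.
Proof.
have [p [xp <- <-]] := dist_witness x y.
have [q [yq <- <-]] := dist_witness (last x p) z.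
by rewrite -last_cat -size_cat dist_path // cat_path xp.
Qed.

Lemma dist_edge x y : e x y -> d x y <= 1.
Proof. by move=> xy; apply: (@dist_path x [:: y]); rewrite /= xy. Qed.

Lemma dist_sym x y : d x y = d y x.
Proof.
suff le a b : d a b <= d b a by apply/eqP; rewrite eqn_leq !le.
have [p [ap <- <-]] := dist_witness b a.
have /dist_path : path e (last b p) (rev (belast b p)).
  by rewrite rev_path; apply: sub_path ap => u w; rewrite sym.
rewrite size_rev size_belast.
have -> : last (last b p) (rev (belast b p)) = b; last by [].
by case: p {ap} => //= z p; rewrite rev_cons last_rcons.
Qed.

Lemma dist_eq0 x y : (d x y == 0) = (x == y).
Proof.
apply/eqP/eqP => [|->]; last exact: distxx.
by have [[|z p] [_ /= E <-]] := dist_witness x y.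
Qed.

Lemma dist_pred x y : 0 < d x y -> exists2 z, e z y & d x y = (d x z).+1.
Proof.
have [p [xp yE pE]] := dist_witness x y; rewrite -pE.
case: (lastP p) xp yE pE => // q z; rewrite rcons_path last_rcons size_rcons.
case/andP=> xq qz zy dE _; subst z; exists (last x q) => //.
have := dist_path xq; have := dist_triangle (last x q) x y.
by have := dist_edge qz; lia.
Qed.

Lemma dist_parity (c : T -> bool) x y : (forall a b, e a b -> c a != c b) ->
  c y = c x (+) odd (d x y).
Proof.
move=> cP; have [p [xp <- <-]] := dist_witness x y.
elim: p x xp => [|z p IHp] x /=; first by rewrite addbF.
case/andP => /cP xz /IHp ->; move: xz.
by case: (c x) (c z) (odd _) => [] [] [].
Qed.

Lemma dist_edge_step x y z : bipartite e -> e y z ->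
  d x z = (d x y).+1 \/ d x y = (d x z).+1.
Proof.
move=> [c cP] yz; have := dist_edge yz; have := dist_edge yz.
rewrite {1}dist_sym; have := dist_triangle y x z; have := dist_triangle z x y.
have := cP _ _ yz; rewrite (dist_parity x y cP) (dist_parity x z cP).
case: (c x) => /=; lia.
Qed.

Lemma dist_ancestor x y i : i <= d x y ->
  exists2 s, d x s = i & d s y + i = d x y.
Proof.
move Dm : (d x y - i) => m; elim: m y Dm => [|m IHm] y Dm le_iy.
  by exists y; rewrite ?distxx; lia.
have [|z zy dE] := @dist_pred x y; first by lia.
have [||s ds dsz] := IHm z; [lia|lia|exists s => //].
have := dist_triangle z s y; have := dist_triangle s x y.
by have := dist_edge zy; lia.
Qed.

Lemma ecc_ub v x : d v x <= ecc e v.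
Proof. exact: (@leq_bigmax _ (fun x => d v x)). Qed.

Lemma ecc_witness v : exists x, d v x = ecc e v.
Proof.
have [|x E] := @bigop.eq_bigmax T (fun x => d v x); last by exists x; rewrite /ecc E.
by apply/card_gt0P; exists v.
Qed.

Lemma radius_le_ecc v : radius e <= ecc e v.
Proof.
rewrite /radius; have := mem_index_enum v.
elim: (index_enum T) => //= u s IHs; rewrite inE big_cons geq_min.
by case/predU1P => [->|/IHs ->]; rewrite ?leqnn ?orbT.
Qed.

Lemma radius_witness v : exists x, radius e <= d v x.
Proof. by have [x dE] := ecc_witness v; exists x; rewrite dE radius_le_ecc. Qed.

End Distance.

(** A path from [x] avoiding [P] never leaves [Q], so [P] separates [x] from [y]. *)
Lemma cut_card (T : finType) (e : rel T) k (Q P : {set T}) x y :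
  k_connected k e -> x \in Q -> x \notin P -> y \notin Q -> y \notin P ->
  (forall a b, a \in Q -> b \notin Q -> e a b -> b \in P) -> k <= #|P|.
Proof.
move=> [_ kcon] xQ xP yQ yP bd; rewrite leqNgt; apply/negP => /kcon /(_ x y xP yP).
case/connectP => p pP yE; case/negP: yQ; rewrite {}yE {yP}.
elim: p x xQ {xP} pP => //= z p IHp x xQ /andP[/and3P[xz _ zP]]; apply: IHp.
by apply: contraR zP => zQ; apply: bd xz.
Qed.

(** With fewer than [k] neighbours, [x] would be separated by them from some other vertex, as there
    are more than [k] vertices. *)
Lemma k_connected_degree (T : finType) (e : rel T) k x :
  irreflexive e -> k_connected k e -> k <= #|[set y | e x y]|.
Proof.
move=> irr kcon; rewrite leqNgt; apply/negP => lt_k.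
have /subsetPn[y _] : ~~ ([set: T] \subset x |: [set y | e x y]).
  apply/negP => /subset_leq_card; rewrite cardsT cardsU1.
  by have := kcon.1; case: (_ \notin _) => /=; lia.
rewrite !inE => /norP[yx xy].
have: k <= #|[set y | e x y]|; last by rewrite leqNgt lt_k.
apply: (cut_card (Q := [set x]) (x := x) (y := y) kcon); rewrite ?inE ?eqxx ?irr //.
by move=> a b; rewrite !inE => /eqP->.
Qed.

(** * Levels and the cuts inside small levels *)

Section Levels.

Variables (T : finType) (e : rel T) (k : nat) (v : T).
Hypothesis quad : quadrangulation e.
Hypothesis k_gt0 : 0 < k.
Hypothesis kcon : k_connected k e.

Notation d := (dist e).
Notation L := (dist e v).

Let sym : symmetric e. Proof. by case: quad => -[]. Qed.
Let irr : irreflexive e. Proof. by case: quad => -[]. Qed.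
Let con : forall x y, connect e x y.
Proof. by case: quad => _ con2 _ _ _; apply: k_connected_connect con2. Qed.
Let bip : bipartite e. Proof. by case: quad. Qed.

Definition level i : {set T} := [set x | L x == i].

(* The truncated [i.-1] makes [link 0] meaningless; only [0 < i] matters. *)
Definition link i : rel T := [rel s t |
  [exists z, [&& L z == i.-1, e z s & e z t]] &&
  [exists c, [&& L c == i.+1, e c s & e c t]]].

Lemma link_sym i : symmetric (link i).
Proof.
by move=> s t; congr andb; apply: eq_existsb => z; rewrite [e z s && _]andbC.
Qed.

Lemma level_step x y : e x y -> L y = (L x).+1 \/ L x = (L y).+1.
Proof. exact: dist_edge_step. Qed.

Lemma level_card i : 0 < i < ecc e v -> k <= #|level i|.
Proof.
case/andP=> i_gt0 lt_iR; have [w wE] := ecc_witness e v.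
apply: (cut_card (Q := [set x | i < L x]) (x := w) (y := v) kcon);
  rewrite ?inE ?distxx ?wE //; try lia.
by move=> a b; rewrite !inE => ia ib /level_step; lia.
Qed.

(** [S] is a link component of the level. The edges going down from [S] form a cocycle, hence the
    coboundary of some [f], which is constant below level [i] and, within it, differs from [f v]
    exactly on [S]. If [f] took the value [f v] anywhere above, both [S] and the rest of the level
    would have at least [k] vertices. *)
Lemma level_cut i : 0 < i < ecc e v -> #|level i| < k.*2 ->
  exists S : {set T}, [/\ S \subset level i, k <= #|S|,
    forall y s, i < L y -> L s = i -> d s y + i = L y -> s \in S &
    forall (P : {set T}) p q, p \in S -> p \in P -> q \in S -> q \notin P ->
      exists s t, [/\ s \in S, s \in P, t \in S, t \notin P & link i s t]].
Proof.
case/andP=> i_gt0 lt_iR small; have [w wE] := ecc_witness e v.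
have [|s0 s0i s0w] := @dist_ancestor T e con v w i; first by rewrite wE ltnW.
have [S S_con] : exists S : {set T}, forall t, (t \in S) = connect (link i) s0 t.
  by exists [set t | connect (link i) s0 t] => t; rewrite inE.
have s0S : s0 \in S by rewrite S_con connect0.
have linkS s t : s \in S -> link i s t -> t \in S.
  by rewrite !S_con => s0s st; apply: connect_trans s0s (connect1 st).
have link_level s t : link i s t -> L t = i.
  case/andP=> /existsP[z /and3P[/eqP zi _ zt]] /existsP[c /and3P[/eqP ci _ ct]].
  by have [] := level_step zt; have [] := level_step ct; lia.
have S_level s : s \in S -> L s = i.
  rewrite S_con => /connectP[p]; case: (lastP p) => [|q z] /=; first by move=> _ ->.
  by rewrite rcons_path last_rcons => /andP[_ /link_level] zi ->.
pose h x y : 'F_2 :=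
  (((x \in S) && (L y < i)%N)%:R + ((y \in S) && (L x < i)%N)%:R)%R.
(* In such a 4-cycle [b] and [f] witness a link between [a] and [c]. *)
have square a b c f : e a b -> e b c -> e c f -> e f a ->
    a \in S -> L b < i -> ~~ (L f < i) -> c \in S.
  move=> ab bc cf fa aS lb lf; have la := S_level _ aS.
  have lb' : L b = i.-1 by have := level_step ab; lia.
  have lf' : L f = i.+1 by have := level_step fa; lia.
  apply: linkS aS _; apply/andP; split; apply/existsP; [exists b | exists f].
    by rewrite lb' eqxx sym ab.
  by rewrite lf' eqxx fa sym.
(* The sum of [h] around a 4-cycle is the sum of two such products, one for each pair of opposite
   corners. *)
have opposite a b c f : e a b -> e b c -> e c f -> e f a ->
    (((a \in S)%:R + (c \in S)%:R) * ((L b < i)%N%:R + (L f < i)%N%:R) = 0 :> 'F_2)%R.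
  move=> ab bc cf fa; have [cb ba] : e c b /\ e b a by rewrite ![e _ b]sym [e b a]sym.
  have [af fc] : e a f /\ e f c by rewrite ![e _ f]sym [e f c]sym.
  have S1 := square a b c f ab bc cf fa; have S2 := square c b a f cb ba af fc.
  have S3 := square a f c b af fc cb ba; have S4 := square c f a b cf fa ab bc.
  move: S1 S2 S3 S4; case: (a \in S); case: (c \in S); case: (L b < i);
    case: (L f < i) => /= S1 S2 S3 S4;
  first [by apply/eqP | by have := S1 isT isT isT | by have := S2 isT isT isT
    | by have := S3 isT isT isT | by have := S4 isT isT isT].
have coc : square_cocycle e h.
  split; first by move=> x y; rewrite /h GRing.addrC.
  move=> a b c f ab bc cf fa.
  have := opposite a b c f ab bc cf fa; have := opposite b c f a bc cf fa ab.
  rewrite /h; case: (a \in S); case: (b \in S); case: (c \in S); case: (f \in S);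
  case: (L a < i); case: (L b < i); case: (L c < i); case: (L f < i) => /= E1 E2;
  first [by apply/eqP | by have := congr1 val E1 | by have := congr1 val E2].
have [f fE] := square_cocycle_coboundary quad coc.
have f_same x y : e x y -> i <= L x -> i <= L y -> f x = f y.
  move=> xy ix iy; apply: F2_eq; rewrite -fE // /h !ltnNge ix iy !andbF.
  by apply/eqP.
have f_below x : L x < i -> f x = f v.
  move Dm : (L x) => m; elim: m x Dm => [|m IHm] x Dm lt_i.
    by have /eqP := Dm; rewrite dist_eq0 // => /eqP ->.
  have [|z zx zE] := @dist_pred T e con v x; first by lia.
  rewrite -(IHm z); try lia.
  apply: F2_eq; rewrite -fE 1?sym // /h.
  have -> : (x \in S) = false by apply/negP => /S_level; lia.
  have -> : (z \in S) = false by apply/negP => /S_level; lia.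
  by apply/eqP.
have f_above y s : L s = i -> d s y + i = L y -> f y = f s.
  move Dm : (d s y) => m; elim: m y Dm => [|m IHm] y Dm si dE.
    by have /eqP := Dm; rewrite dist_eq0 // => /eqP ->.
  have [|z zy zE] := @dist_pred T e con s y; first by lia.
  have := dist_triangle con s v z; have := level_step zy => ? ?.
  by rewrite -(IHm z) //; try lia; apply: f_same; rewrite 1?sym //; lia.
have f_S s : L s = i -> (s \in S) = (f s != f v).
  move=> si; have [|z zs zE] := @dist_pred T e con v s; first by lia.
  have := fE _ _ zs; rewrite (f_below z) /h; last by lia.
  have -> : L z < i by lia.
  have -> : (z \in S) = false by apply/negP => /S_level; lia.
  rewrite andbT /= GRing.add0r; case: (s \in S) => hE.
    apply/esym/eqP => fs; move: hE; rewrite fs F2_addrr => /eqP //.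
  by apply/esym/negbTE; rewrite negbK; apply/eqP/esym/F2_eq.
(* Every edge leaving [Q b] ends in level [i], at a vertex with the same value of [f]. *)
pose Q b := [set x | (i < L x) && ((f x != f v) == b)].
have cut b x : x \in Q b -> k <= #|[set s in level i | (s \in S) == b]|.
  move=> xQ; apply: (cut_card (Q := Q b) (x := x) (y := v) kcon) => //.
  - by move: xQ; rewrite !inE => /andP[ix _]; apply/negP => /andP[/eqP]; lia.
  - by rewrite !inE distxx.
  - by rewrite !inE distxx //; apply/negP => /andP[/eqP]; lia.
  move=> a c; rewrite !inE => /andP[ia /eqP fa] cN ac.
  have fc : f c = f a by apply: f_same; rewrite 1?sym //; have := level_step ac; lia.
  have ci : L c = i by move: cN; rewrite fc fa eqxx andbT; have := level_step ac; lia.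
  by rewrite ci eqxx f_S // fc fa /=.
have SE : S = [set s in level i | (s \in S) == true].
  apply/setP => s; rewrite !inE eqb_id.
  by apply/idP/andP => [sS|[]] //; rewrite S_level ?eqxx.
have wQ : w \in Q true.
  by rewrite inE wE lt_iR eqb_id (f_above w s0) // -f_S.
have S_card : k <= #|S| by rewrite SE; apply: cut wQ.
have all_S y : i < L y -> f y != f v.
  move=> iy; apply: contraLR small => fy; rewrite -leqNgt -addnn.
  have yQ : y \in Q false by rewrite inE iy (negPf fy).
  apply: leq_trans (leq_add S_card (cut _ _ yQ)) _.
  rewrite {1}SE -cardUI [X in _ + X]eq_card0 ?addn0 => [|s]; last first.
    by rewrite !inE; case: (s \in S); rewrite /= !(andbF, andbT).
  apply: subset_leq_card; apply/subsetP => s; rewrite !inE.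
  by case/orP => /andP[].
exists S; split=> // [|y s iy si sy|P p q pS pP qS qP].
- by apply/subsetP => s /S_level; rewrite inE => ->.
- by rewrite f_S // -(f_above y s) // all_S.
(* If no link left [P], a chain of links from [p] would stay in [P] and never reach [q]. *)
have [/existsP[s /existsP[t /and5P[]]]|noL] :=
    boolP [exists s, exists t, [&& s \in S, s \in P, t \in S, t \notin P & link i s t]].
  by exists s, t.
suff : q \in P by rewrite (negPf qP).
have /connectP[r pr ->] : connect (link i) p q.
  move: pS qS; rewrite !S_con => s0p; apply: connect_trans.
  by rewrite (sym_connect_sym (@link_sym i)).
elim: r p pS pP pr => //= z r IHr p pS pP /andP[pz]; apply: IHr.
  exact: linkS pz.
apply: contraNT noL => zP; apply/existsP; exists p; apply/existsP; exists z.
by rewrite pS pP (linkS p) // zP pz.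
Qed.

End Levels.

(** * Domination in small connected sets *)

Section SmallConnected.

Variables (T : finType) (lk : rel T) (S : {set T}).
Hypothesis lk_sym : symmetric lk.

(** Connectedness of the graph induced by [lk] on [S], in terms of cuts so that a crossing link is
    at hand. *)
Definition linked_set : Prop :=
  forall (P : {set T}) p q, p \in S -> p \in P -> q \in S -> q \notin P ->
    exists s t, [/\ s \in S, s \in P, t \in S, t \notin P & lk s t].

Hypothesis lkS : linked_set.

Lemma size_le_card (s : seq T) : uniq s -> all (mem S) s -> size s <= #|S|.
Proof.
move=> us /allP sS; rewrite -(card_uniqP us); apply: subset_leq_card.
by apply/subsetP => x /sS.
Qed.

Lemma linked_neighbour s : s \in S -> 1 < #|S| ->
  exists t, [/\ t \in S, t != s & lk s t].
Proof.
move=> sS S_gt1; have /subsetPn[q qS] : ~~ (S \subset [set s]).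
  by apply: contraTN S_gt1 => /subset_leq_card; rewrite cards1 -leqNgt.
move=> qs; have [a [t [aS]]] := lkS sS (set11 s) qS qs.
by rewrite !inE => /eqP-> tS ts st; exists t.
Qed.

(** A third vertex [w] has a neighbour in [S], which leaves only [s] and [t]. *)
Lemma dominating_edge3 s t w : #|S| <= 3 -> s \in S -> t \in S -> s != t ->
  w \in S -> [|| w == s, w == t, lk s w | lk t w].
Proof.
move=> S3 sS tS st wS.
have [//|ws] := eqVneq w s; have [//|wt] := eqVneq w t.
have [|a [aS aw wa]] := linked_neighbour wS.
  by apply: (@size_le_card [:: s; t]); rewrite /= ?inE ?st ?sS ?tS.
have [E|as_] := eqVneq a s; first by rewrite -E [lk a w]lk_sym wa.
have [E|at_] := eqVneq a t; first by rewrite -E [lk a w]lk_sym wa !orbT.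
have := @size_le_card [:: s; t; w; a]; rewrite /= !inE !negb_or st sS tS wS aS.
rewrite ![s == _]eq_sym ![t == _]eq_sym [w == a]eq_sym ws as_ wt at_ aw.
by move=> /(_ isT isT) /leq_trans/(_ S3).
Qed.

(** If [s] misses [w], a neighbour [a] of [s] is linked to [w] too and is the centre. *)
Lemma dominating_vertex3 : 0 < #|S| <= 3 ->
  exists2 s, s \in S & forall w, w \in S -> (w == s) || lk s w.
Proof.
case/andP => /card_gt0P[s sS] S3.
have [/forall_inP sP|/forall_inPn[w wS]] :=
  boolP [forall w in S, (w == s) || lk s w]; first by exists s.
case/norP=> ws sw.
have [|a [aS as_ sa]] := linked_neighbour sS.
  by apply: (@size_le_card [:: w; s]); rewrite /= ?inE ?ws ?sS ?wS.
have aw : lk a w.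
  have := @dominating_edge3 s a w S3 sS aS; rewrite eq_sym as_ => /(_ isT wS).
  rewrite (negPf ws) (negPf sw) /= => /orP[/eqP wa|//].
  by rewrite wa sa in sw.
exists a => // x xS; have [//|xa] := eqVneq x a.
have [->|xs] := eqVneq x s; first by rewrite lk_sym.
have [->//|xw] := eqVneq x w.
have wa : w != a by apply: contraNneq sw => ->.
have := @size_le_card [:: x; w; a; s]; rewrite /= !inE !negb_or xa xs xw ws wa.
by rewrite as_ sS aS wS xS => /(_ isT isT) /leq_trans/(_ S3).
Qed.

(** If the edge from [s] to [a] misses [w], a link leads from one end [x] of it to a fourth vertex
    [b]. Then [b] is linked to [w], and the edge from [x] to [b] dominates. *)
Lemma dominating_edge4 : 1 < #|S| <= 4 -> exists s t,
  [/\ s \in S, t \in S, lk s t &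
    forall w, w \in S -> [|| w == s, w == t, lk s w | lk t w]].
Proof.
case/andP => S_gt1 S4.
have /card_gt0P[s sS] : 0 < #|S| by lia.
have [a [aS as_ sa]] := linked_neighbour sS S_gt1.
have [/forall_inP sP|/forall_inPn[w wS]] :=
  boolP [forall w in S, [|| w == s, w == a, lk s w | lk a w]]; first by exists s, a.
case/norP=> ws /norP[wa /norP[sw aw]].
have [||||x [b [xS xP bS bP xb]]] := lkS (P := [set s; a]) (p := s) (q := w);
  rewrite ?inE ?eqxx ?(negPf ws) ?(negPf wa) //.
move: xP bP; rewrite !inE negb_or => xP /andP[bs ba].
have wb : w != b.
  by apply: contraTneq xb => <-; case/orP: xP => /eqP->; rewrite ?(negPf sw) ?(negPf aw).
have S_E y : y \in S -> [|| y == s, y == a, y == b | y == w].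
  move=> yS; apply: contraLR S4 => /norP[ys /norP[ya /norP[yb yw]]].
  rewrite -ltnNge; apply: (@size_le_card [:: y; w; b; a; s]);
    by rewrite /= ?inE ?negb_or ?ys ?ya ?yb ?yw ?ws ?wa ?wb ?bs ?ba ?as_ ?sS ?aS ?bS ?wS ?yS.
have bw : lk b w.
  have [y [yS yw wy]] := linked_neighbour wS S_gt1.
  case/or4P: (S_E y yS) => /eqP E; rewrite E in wy yw.
  - by rewrite lk_sym (negPf sw) in wy.
  - by rewrite lk_sym (negPf aw) in wy.
  - by rewrite lk_sym.
  - by rewrite eqxx in yw.
case/orP: xP => /eqP E; rewrite {}E in xb.
  exists s, b; split=> // y yS.
  by case/or4P: (S_E y yS) => /eqP->; rewrite ?eqxx ?sa ?bw ?orbT.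
exists a, b; split=> // y yS.
by case/or4P: (S_E y yS) => /eqP->; rewrite ?eqxx ?bw 1?[lk _ s]lk_sym ?sa ?orbT.
Qed.

Definition within2 s t :=
  [|| t == s, lk s t | [exists m, (m \in S) && (lk s m && lk m t)]].

(** If [s] is not a centre, some geodesic of links [s], [a], [b], [x] starts there. If [a] is not
    one either, a fifth vertex [w] is more than two links away from [a]; it can only be linked to
    [x], so [b] is a centre. *)
Lemma linked_radius5 : 0 < #|S| <= 5 ->
  exists2 s, s \in S & forall w, w \in S -> within2 s w.
Proof.
case/andP => /card_gt0P[s sS] S5.
have [/forall_inP sP|/forall_inPn[q qS qN]] := boolP [forall w in S, within2 s w].
  by exists s.
have [||b [x [bS bP xS xP bx]]] := lkS (P := [set w | within2 s w]) sS _ qS.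
- by rewrite inE /within2 eqxx.
- by rewrite inE.
move: bP xP; rewrite !inE => bP xP.
have bs : b != s by apply: contraNneq xP => bE; rewrite /within2 -bE bx orbT.
have sb : ~~ lk s b.
  by apply: contra xP => sb; apply/or3P/Or33/existsP; exists b; rewrite bS sb.
move: bP; rewrite /within2 (negPf bs) (negPf sb) /= => /existsP[a /and3P[aS sa ab]].
have within s' m t : m \in S -> lk s' m -> lk m t -> within2 s' t.
  by move=> mS sm mt; apply/or3P/Or33/existsP; exists m; rewrite mS sm.
have within1 s' t : lk s' t -> within2 s' t by rewrite /within2 => ->; rewrite orbT.
have within0 s' : within2 s' s' by rewrite /within2 eqxx.
have as_ : a != s by apply: contraNneq sb => <-.
have ba : b != a by apply: contraNneq sb => ->.
have xs : x != s by apply: contraNneq xP => ->.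
have xa : x != a by apply: contraNneq xP => ->; apply: within1.
have xb : x != b by apply: contraNneq xP => ->; apply: within ab.
have [/forall_inP aP|/forall_inPn[w wS wN]] := boolP [forall w in S, within2 a w].
  by exists a.
have ws : w != s by apply: contraNneq wN => ->; rewrite within1 // lk_sym.
have wa : w != a by apply: contraNneq wN => ->.
have wb : w != b by apply: contraNneq wN => ->; apply: within1.
have wx : w != x by apply: contraNneq wN => ->; apply: within bx.
have S_E y : y \in S -> [|| y == s, y == a, y == b, y == x | y == w].
  move=> yS; apply: contraLR S5 => /norP[ys /norP[ya /norP[yb /norP[yx yw]]]].
  rewrite -ltnNge; apply: (@size_le_card [:: y; w; x; b; a; s]);
    by rewrite /= ?inE ?negb_or ?ys ?ya ?yb ?yx ?yw ?ws ?wa ?wb ?wx ?xs ?xa ?xb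
      ?bs ?ba ?as_ ?sS ?aS ?bS ?xS ?wS ?yS.
exists b => // y /S_E /or4P[/eqP->|/eqP->|/eqP->|/orP[/eqP->|/eqP->]].
- by apply: (within _ a); rewrite // lk_sym.
- by apply: within1; rewrite lk_sym.
- exact: within0.
- exact: within1.
have [|t [tS tw wt]] := linked_neighbour wS.
  by apply: (@size_le_card [:: w; s]); rewrite /= ?inE ?ws ?sS ?wS.
rewrite lk_sym in wt; case/or4P: (S_E t tS) => [/eqP E|/eqP E|/eqP E|/orP[]/eqP E];
  rewrite {}E in wt tw.
- by case/negP: wN; apply: (within _ s); rewrite // lk_sym.
- by case/negP: wN; apply: within1.
- by case/negP: wN; apply: (within _ b).
- exact: (within _ x).
- by rewrite eqxx in tw.
Qed.

End SmallConnected.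

(** * Sizes of the levels *)

Section FarVertices.

Variables (T : finType) (e : rel T) (v : T).
Hypothesis sym : symmetric e.
Hypothesis con : forall x y, connect e x y.

Notation d := (dist e).
Notation L := (dist e v).
Notation r := (radius e).
Notation R := (ecc e v).
Notation level := (level e v).
Notation link := (link e v).

(** A link-connected part of level [i] through which all geodesics from [v] to higher vertices
    pass. *)
Definition cutset i (S : {set T}) : Prop :=
  [/\ S \subset level i,
    forall y s, i < L y -> L s = i -> d s y + i = L y -> s \in S &
    linked_set (link i) S].

(** For [u] of level [j] within [i - j + E] of all of [S], this forces the vertices at distance at
    least [r] from [u] to lie above level [i]. In the first case the detour through [v] is too
    short; in the second it leaves only level [i], which is inside [S] and hence closer than [r]. *)
Definition below_radius E i j (S : {set T}) : Prop :=
  i + j < r \/ [/\ level i \subset S, i + j <= r & E < j.*2].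

Lemma cutset_level i S s : cutset i S -> s \in S -> L s = i.
Proof. by case=> /subsetP sub _ _ /sub; rewrite inE => /eqP. Qed.

(** A vertex [y] at distance at least [r] from [u] is above level [i]; passing through an ancestor
    of [y] in [S] bounds this distance by [L y - j + E]. *)
Lemma far_vertex E i j S u : cutset i S -> L u = j ->
  (forall s, s \in S -> d u s + j <= i + E) -> below_radius E i j S ->
  exists y, [/\ i < L y, r <= d u y & r + j <= L y + E].
Proof.
move=> [_ anc _] uj cov dom; have [y ry] := radius_witness e u.
have uy := dist_triangle con v u y; rewrite [d u v](dist_sym sym con) uj in uy.
have iy : i < L y.
  case: dom => [lt_r|[/subsetP sub le_r lt_E]]; first by lia.
  rewrite ltnNge; apply/negP => yi; have yiE : L y = i by lia.
  by have := cov y; rewrite sub ?inE ?yiE // => /(_ isT); lia.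
have [s si sy] := dist_ancestor con (ltnW iy).
have := cov s (anc _ _ iy si sy); have := dist_triangle con s u y.
by exists y; split=> //; lia.
Qed.

Lemma link_dist i s t : link i s t -> d s t <= 2.
Proof.
case/andP => /existsP[z /and3P[_ zs zt]] _.
have := dist_triangle con z s t; have := dist_edge zt.
by rewrite sym in zs; have := dist_edge zs; lia.
Qed.

Lemma within2_dist i S s t : within2 (link i) S s t -> d s t <= 4.
Proof.
case/or3P => [/eqP->|/link_dist|/existsP[m /and3P[_ /link_dist sm /link_dist mt]]].
- by rewrite distxx.
- by move/leq_trans; apply.
- by have := dist_triangle con m s t; lia.
Qed.

Lemma link_parent i j s t : 0 < i -> j < i -> link i s t ->
  exists u, [/\ L u = j, d u s + j <= i & d u t + j <= i].
Proof.
move=> i_gt0 ji /andP[/existsP[z /and3P[/eqP zi zs zt]] _].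
have [|u uj uz] := @dist_ancestor T e con v z j; first by rewrite zi; lia.
exists u; split=> //; [have := dist_triangle con z u s | have := dist_triangle con z u t].
  by have := dist_edge zs; lia.
by have := dist_edge zt; lia.
Qed.

(** Take [u] below a dominating vertex of [S]. *)
Lemma vertex_far i j S : cutset i S -> 0 < #|S| <= 3 -> j <= i ->
  below_radius 2 i j S -> r + j <= R + 2.
Proof.
move=> cutS S3 ji dom; have [_ _ lkS] := cutS.
have [s sS domS] := dominating_vertex3 (@link_sym _ _ _ _) lkS S3.
have si := cutset_level cutS sS.
have [|u uj us] := @dist_ancestor T e con v s j; first by rewrite si.
have [w wS|y [_ _ ry]] := far_vertex cutS uj _ dom.
  have := dist_triangle con s u w; case/orP: (domS w wS) => [/eqP->|/link_dist].
    by rewrite distxx; lia.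
  by lia.
by have := ecc_ub e v y; lia.
Qed.

(** Take [u] below a vertex from which two links reach all of [S]. *)
Lemma radius_far i j S : cutset i S -> 0 < #|S| <= 5 -> j <= i ->
  below_radius 4 i j S -> r + j <= R + 4.
Proof.
move=> cutS S5 ji dom; have [_ _ lkS] := cutS.
have [s sS domS] := linked_radius5 (@link_sym _ _ _ _) lkS S5.
have si := cutset_level cutS sS.
have [|u uj us] := @dist_ancestor T e con v s j; first by rewrite si.
have [w wS|y [_ _ ry]] := far_vertex cutS uj _ dom.
  have := dist_triangle con s u w; have := within2_dist (domS w wS).
  by lia.
by have := ecc_ub e v y; lia.
Qed.

(* Beyond [s] and [t] there is nothing at distance [r] from [u], as [u] is on
   geodesics from [v] to both of them *)
Lemma edge_far i j S s t : cutset i S -> 0 < i -> j < i -> s \in S -> t \in S ->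
  link i s t ->
  (forall w, w \in S -> [|| w == s, w == t, link i s w | link i t w]) ->
  below_radius 2 i j S ->
  exists y, [/\ i < L y, r + j <= L y + 2 & L y < r + j ->
    d s y + i <> L y /\ d t y + i <> L y].
Proof.
move=> cutS i_gt0 ji sS tS st domS dom.
have [u [uj us ut]] := link_parent i_gt0 ji st.
have [w wS|y [iy ry rjy]] := far_vertex cutS uj _ dom.
  have := dist_triangle con s u w; have := dist_triangle con t u w.
  by case/or4P: (domS w wS) => [/eqP->|/eqP->|/link_dist|/link_dist]; lia.
exists y; split=> // lt_rj.
by split=> E; [have := dist_triangle con s u y | have := dist_triangle con t u y]; lia.
Qed.

Lemma edge_far_le i j S : cutset i S -> 1 < #|S| <= 4 -> 0 < i -> j < i ->
  below_radius 2 i j S -> r + j <= R + 2.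
Proof.
move=> cutS S4 i_gt0 ji dom; have [_ _ lkS] := cutS.
have [s [t [sS tS st domS]]] := dominating_edge4 (@link_sym _ _ _ _) lkS S4.
have [y [_ ry _]] := edge_far cutS i_gt0 ji sS tS st domS dom.
by have := ecc_ub e v y; lia.
Qed.

(** The two vertices of [S] are linked, so one [u] lies below both and [E] is 0. *)
Lemma pair_far i j S : cutset i S -> #|S| = 2 -> 0 < i -> j < i -> i + j < r ->
  r + j <= R.
Proof.
move=> cutS S2 i_gt0 ji ijr; have [_ anc lkS] := cutS.
have /card_gt0P[s sS] : 0 < #|S| by rewrite S2.
have [|t [tS ts st]] := linked_neighbour lkS sS; first by rewrite S2.
have [u [uj us ut]] := link_parent i_gt0 ji st.
have [w wS||y [_ _ ry]] := @far_vertex 0 i j S u cutS uj; [|by left|]; last first.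
  by have := ecc_ub e v y; lia.
have [->|ws] := eqVneq w s; first by lia.
have [->|wt] := eqVneq w t; first by lia.
have := @size_le_card _ S [:: w; t; s]; rewrite /= !inE !negb_or ws wt ts.
by rewrite wS tS sS S2 => /(_ isT isT).
Qed.

(** For a linked pair, [edge_far] gives [y1] whose only ancestor in [S] is the third vertex [a]; for
    a linked pair containing [a], it gives [y2] that is not beyond [a]. *)
Lemma two_far i j S : cutset i S -> #|S| = 3 -> 0 < i -> j < i ->
  below_radius 2 i j S -> R < r + j ->
  exists y1 y2, [/\ i < L y1, r + j <= L y1 + 2, i < L y2, r + j <= L y2 + 2 &
    forall s, L s = i -> d s y1 + i = L y1 -> d s y2 + i = L y2 -> False].
Proof.
move=> cutS S3 i_gt0 ji dom Rr; have [_ anc lkS] := cutS.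
have S3' : #|S| <= 3 by rewrite S3.
have S1 : 1 < #|S| by rewrite S3.
have small y : L y < r + j by have := ecc_ub e v y; lia.
have edge s t : s \in S -> t \in S -> t != s -> link i s t ->
    exists y, [/\ i < L y, r + j <= L y + 2, d s y + i <> L y & d t y + i <> L y].
  move=> sS tS ts st.
  have [|y [iy ry /(_ (small y)) [sy ty]]] := edge_far cutS i_gt0 ji sS tS st _ dom.
    move=> w wS; apply: (dominating_edge3 (@link_sym _ _ _ _) lkS S3' sS tS _ wS).
    by rewrite eq_sym.
  by exists y.
have /card_gt0P[s sS] : 0 < #|S| by rewrite S3.
have [t [tS ts st]] := linked_neighbour lkS sS S1.
have [y1 [iy1 ry1 sy1 ty1]] := edge s t sS tS ts st.
have [a ai ay1] := dist_ancestor con (ltnW iy1).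
have aS := anc _ _ iy1 ai ay1.
have [b [bS ba ab]] := linked_neighbour lkS aS S1.
have [y2 [iy2 ry2 ay2 by2]] := edge a b aS bS ba ab.
exists y1, y2; split=> // w wi wy1 wy2.
have wS := anc _ _ iy1 wi wy1.
have ws : w != s by apply/eqP => E; rewrite E in wy1.
have wt : w != t by apply/eqP => E; rewrite E in wy1.
have wa : w != a by apply/eqP => E; rewrite E in wy2.
have as_ : a != s by apply/eqP => E; rewrite E in ay1.
have at_ : a != t by apply/eqP => E; rewrite E in ay1.
have := @size_le_card _ S [:: w; a; t; s]; rewrite /= !inE !negb_or ws wt wa as_ at_ ts.
by rewrite wS aS tS sS S3 => /(_ isT isT).
Qed.

End FarVertices.

Section LevelSizes.

Variables (T : finType) (e : rel T) (v : T).
Hypothesis quad : quadrangulation e.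

Notation d := (dist e).
Notation L := (dist e v).
Notation r := (radius e).
Notation R := (ecc e v).
Notation level := (level e v).

Let sym : symmetric e. Proof. by case: quad => -[]. Qed.
Let irr : irreflexive e. Proof. by case: quad => -[]. Qed.
Let con : forall x y, connect e x y.
Proof. by case: quad => _ con2 _ _ _; apply: k_connected_connect con2. Qed.
Let bip : bipartite e. Proof. by case: quad. Qed.
Let con2 : k_connected 2 e. Proof. by case: quad. Qed.
Let rR : r <= R. Proof. exact: radius_le_ecc. Qed.

Lemma small_level_cutset k i : 0 < k -> k_connected k e -> 0 < i < R ->
  #|level i| < k.*2 ->
  exists S, [/\ cutset e v i S, k <= #|S|, #|S| <= #|level i| &
    level i \subset S \/ #|S| < #|level i|].
Proof.
move=> k_gt0 kcon iR small.
have [S [sub kS anc lkS]] := level_cut quad k_gt0 kcon iR small.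
exists S; split=> //; first exact: subset_leq_card.
have [le_S|] := leqP #|level i| #|S|; last by right.
left; have := subset_leqif_cards sub; case=> _ /esym; rewrite eqn_leq le_S.
by rewrite subset_leq_card // => /eqP ->.
Qed.

(** In this and the next lower bounds, [j] is [R - r + E + 1], the least value for which
    [r + j <= R + E] fails. *)
Lemma level2_ge3 i : R + 2 <= i + r -> i + R + 2 <= r.*2 -> 3 <= #|level i|.
Proof.
move=> iL iU; rewrite leqNgt; apply/negP => n_i.
have [||S [cutS kS Sn _]] := @small_level_cutset 2 i isT con2; try lia.
by have := @pair_far T e v sym con i (R - r + 1) S cutS; lia.
Qed.

Lemma level2_ge4 i : R + 3 <= i + r -> i + R + 4 <= r.*2 -> 4 <= #|level i|.
Proof.
move=> iL iU; rewrite leqNgt; apply/negP => n_i.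
have [||S [cutS kS Sn _]] := @small_level_cutset 2 i isT con2; try lia.
suff : r + (R - r + 3) <= R + 2 by lia.
apply: (vertex_far sym con cutS); try lia.
by left; lia.
Qed.

Hypothesis con3 : k_connected 3 e.

Lemma level3_ge4 i : R + 3 <= i + r -> i + R + 3 <= r.*2 -> 4 <= #|level i|.
Proof.
move=> iL iU; rewrite leqNgt; apply/negP => n_i.
have [||S [cutS kS Sn [lS|]]] := @small_level_cutset 3 i isT con3; try lia.
suff : r + (R - r + 3) <= R + 2 by lia.
apply: (vertex_far sym con cutS); try lia.
by right; split=> //; lia.
Qed.

Lemma level3_ge5 i : R + 4 <= i + r -> i + R + 4 <= r.*2 -> 5 <= #|level i|.
Proof.
move=> iL iU; rewrite leqNgt; apply/negP => n_i.
have [||S [cutS kS Sn [lS|Sn']]] := @small_level_cutset 3 i isT con3; try lia.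
  suff : r + (R - r + 3) <= R + 2 by lia.
  apply: (edge_far_le sym con cutS); try lia.
  by right; split=> //; lia.
suff : r + (R - r + 3) <= R + 2 by lia.
apply: (vertex_far sym con cutS); try lia.
by left; lia.
Qed.

Lemma level3_ge6 i : R + 5 <= i + r -> i + R + 5 <= r.*2 -> 6 <= #|level i|.
Proof.
move=> iL iU; rewrite leqNgt; apply/negP => n_i.
have [||S [cutS kS Sn [lS|Sn']]] := @small_level_cutset 3 i isT con3; try lia.
  suff : r + (R - r + 5) <= R + 4 by lia.
  apply: (radius_far sym con cutS); try lia.
  by right; split=> //; lia.
suff : r + (R - r + 3) <= R + 2 by lia.
apply: (edge_far_le sym con cutS); try lia.
by left; lia.
Qed.

Let level_edge := @level_step T e v quad.

Lemma ancestor_up i s x y : e x y -> L y = (L x).+1 -> L s = i ->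
  d s x + i = L x -> d s y + i = L y.
Proof.
move=> xy yE si sx; have := dist_triangle con s v y.
by have := dist_triangle con x s y; have := dist_edge xy; lia.
Qed.

(** Each of [y1] and [y2] has at least three neighbours, all in level [R.-1]; a common one would
    give a common ancestor in level [i]. *)
Lemma disjoint_tops i y1 y2 : i + 1 < R -> L y1 = R -> L y2 = R ->
  (forall s, L s = i -> d s y1 + i = R -> d s y2 + i = R -> False) ->
  2 <= #|level R| /\ 6 <= #|level R.-1|.
Proof.
move=> iR y1R y2R dis.
have down y x : L y = R -> e y x -> L x = R.-1.
  by move=> yR /level_edge; have := ecc_ub e v x; lia.
split.
  have y12 : y1 != y2.
    apply/eqP => E; have [|s si sy] := @dist_ancestor T e con v y1 i; first by lia.
    by apply: (dis s si); rewrite -?E sy.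
  have := @size_le_card _ (level R) [:: y1; y2].
  by rewrite /= !inE y12 y1R y2R eqxx; apply.
have degR y := k_connected_degree y irr con3.
apply: leq_trans (leq_add (degR y1) (degR y2)) _.
rewrite -cardUI [X in _ + X]eq_card0 ?addn0 => [|x].
  apply: subset_leq_card; apply/subsetP => x; rewrite !inE.
  by case/orP => /down ->.
rewrite !inE; apply/negP => /andP[y1x y2x].
have x1 := down _ _ y1R y1x; have x2 := down _ _ y2R y2x.
have [|s si sx] := @dist_ancestor T e con v x i; first by lia.
rewrite sym in y1x; rewrite sym in y2x.
have E1 := ancestor_up y1x _ si _; have E2 := ancestor_up y2x _ si _.
by apply: (dis s si); rewrite ?E1 ?E2 //; lia.
Qed.

(** Here [r + j = R + 2], so both vertices given by [two_far] are in level [R]. *)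
Lemma level3_two_tops i S : cutset e v i S -> #|S| = 3 -> R + 2 < i + r ->
  i + R + 2 <= r.*2 -> below_radius e v 2 i (R - r + 2) S ->
  2 <= #|level R| /\ 6 <= #|level R.-1|.
Proof.
move=> cutS S3 iL iU dom.
have [|||y1 [y2 [iy1 ry1 iy2 ry2 dis]]] := two_far sym con cutS S3 _ _ dom; try lia.
have := ecc_ub e v y1; have := ecc_ub e v y2 => ? ?.
have y1R : L y1 = R by lia.
have y2R : L y2 = R by lia.
apply: (@disjoint_tops i y1 y2) => //; first by lia.
by move=> s si s1 s2; apply: (dis s si); lia.
Qed.

(** This level is just past the range of [level3_ge4]; [S] is the whole level and [i + j = r]. *)
Lemma level3_eq3_tops i : R + 2 < i + r -> i + R + 2 = r.*2 -> #|level i| = 3 ->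
  2 <= #|level R| /\ 6 <= #|level R.-1|.
Proof.
move=> iL iU n_i.
have [||S [cutS kS Sn [lS|]]] := @small_level_cutset 3 i isT con3; try lia.
apply: (level3_two_tops cutS) => //; try lia.
by right; split=> //; lia.
Qed.

(** Just past the range of [level3_ge5], a cutset of four vertices is still impossible, and one of
    three gives two top vertices. *)
Lemma level3_eq4_tops i : R + 3 < i + r -> i + R + 3 = r.*2 -> #|level i| = 4 ->
  2 <= #|level R| /\ 6 <= #|level R.-1|.
Proof.
move=> iL iU n_i.
have [||S [cutS kS Sn [lS|Sn']]] := @small_level_cutset 3 i isT con3; try lia.
  suff : r + (R - r + 3) <= R + 2 by lia.
  apply: (edge_far_le sym con cutS); try lia.
  by right; split=> //; lia.
apply: (level3_two_tops cutS) => //; try lia.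
by left; lia.
Qed.

(* If the levels above [i] have size 3, the unique vertex of the top one is
   beyond all vertices of [S], and so not far away enough *)
Lemma level3_eq4_above i : R + 2 < i + r -> i + R + 2 = r.*2 -> #|level i| = 4 ->
  #|level R| <= 1 -> ~ (forall t, i < t < R -> #|level t| = 3).
Proof.
move=> iL iU n_i nR n3.
have [y yR] := ecc_witness e v.
have topE x : L x = R -> x = y.
  by move=> xR; apply/eqP; move/card_le1P: nR => /(_ y); rewrite !inE yR eqxx => /(_ isT x); rewrite inE xR eqxx => /esym.
(* Downward induction: the ancestors of [y] in level [t] separate [y] from [v], so there are at
   least three of them, which is the whole level. *)
have anc_y t x : i < t <= R -> L x = t -> d x y + t = R.
  move Dm : (R - t) => m; elim: m t Dm x => [|m IHm] t Dm x tR xt.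
    have tE : t = R by lia.
    by rewrite (topE x) ?distxx // xt.
  pose A := [set x in level t | d x y + t == R].
  have A3 : 3 <= #|A|.
    apply: (cut_card (Q := [set x | t < L x]) (x := y) (y := v) con3).
    - by rewrite inE yR; lia.
    - by rewrite !inE yR; lia.
    - by rewrite inE distxx.
    - by rewrite !inE distxx; lia.
    move=> a b; rewrite !inE => ta tb ab; have := level_edge ab => abL.
    have bt : L b = t by lia.
    have := IHm t.+1 _ a; rewrite bt eqxx /=.
    have := dist_triangle con a b y; have := dist_edge ab.
    rewrite (dist_sym sym con a b); have := dist_triangle con b v y; rewrite yR.
    by move=> *; apply/eqP; lia.
  have sub : A \subset level t by apply/subsetP => z; rewrite inE => /andP[].
  have [_ /esym] := subset_leqif_cards sub.
  rewrite n3 ?eqn_leq ?A3 ?andbT; last by lia.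
  have := subset_leq_card sub; rewrite n3; last by lia.
  by move=> -> /eqP/setP/(_ x); rewrite !inE xt eqxx /= => /eqP.
have [||S [cutS kS Sn lS]] := @small_level_cutset 3 i isT con3; try lia.
have [_ anc lkS] := cutS.
have Sy s : s \in S -> d s y + i = R.
  move=> sS; have [|t [_ _]] := linked_neighbour lkS sS; first by lia.
  case/andP=> _ /existsP[c /and3P[/eqP ci cs _]].
  have si := cutset_level cutS sS; rewrite sym in cs.
  have := dist_triangle con c s y; have := dist_edge cs.
  have := dist_triangle con s v y; rewrite yR.
  by have := anc_y _ c _ ci; lia.
case: lS => [lS|Sn'].
  have S4 : 1 < #|S| <= 4 by lia.
  have [s [t [sS tS st domS]]] := dominating_edge4 (@link_sym _ _ _ _) lkS S4.
  have [|||z [iz rz zE]] := @edge_far T e v sym con i (R - r + 2) S s t cutS _ _ sS tS st domS; try lia.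
    by right; split=> //; lia.
  have zR : L z = R by have := ecc_ub e v z; lia.
  by have [|] := zE _; [lia | rewrite (topE z zR) yR Sy].
have S3 : #|S| = 3 by lia.
(* This [j] puts [y1] and [y2] in level [R - 1] or above. Neither is [y], which is beyond all of
   [S], so both are in level [R - 1]. *)
have [||||y1 [y2 [iy1 ry1 iy2 ry2 dis]]] := @two_far T e v sym con i (R - r + 1) S cutS S3; try lia.
  by left; lia.
have below_top z1 z2 : i < L z2 -> R.-1 <= L z1 ->
    (forall s, L s = i -> d s z1 + i = L z1 -> d s z2 + i = L z2 -> False) ->
    L z1 = R.-1.
  move=> iz2 z1R dis12; have := ecc_ub e v z1; rewrite leq_eqVlt => /predU1P[z1E|].
    have [a ai az2] := dist_ancestor con (ltnW iz2).
    by case: (dis12 a ai) => //; rewrite z1E (topE z1 z1E) Sy // (anc z2).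
  by lia.
have y1R : L y1 = R.-1 by apply: (below_top y1 y2) => //; lia.
have y2R : L y2 = R.-1.
  by apply: (below_top y2 y1) => [||s si s2 s1]; [|lia|apply: (dis s si)].
(* Only one neighbour can be in level [R], so [y1] and [y2] have two each in level [R - 2]. These
   four are distinct, too many for [S] or for a level of size 3. *)
pose N z := [set x in [set x | e z x] | L x == R.-2].
have N2 z : L z = R.-1 -> 2 <= #|N z|.
  move=> zR; have deg := k_connected_degree z irr con3.
  have sub : [set x | e z x] \subset N z :|: level R.
    apply/subsetP => x; rewrite !inE => zx; rewrite zx /=.
    by have := level_edge zx; lia.
  have := leq_trans deg (subset_leq_card sub).
  by rewrite cardsU; lia.
have Nanc z x : L z = R.-1 -> x \in N z -> e x z /\ L z = (L x).+1.
  by rewrite !inE => zR /andP[zx /eqP xR]; rewrite sym zx; split=> //; lia.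
have N4 : 4 <= #|N y1 :|: N y2|.
  rewrite cardsU [#|_ :&: _|]eq_card0 ?subn0 => [|x].
    by have := N2 _ y1R; have := N2 _ y2R; lia.
  rewrite in_setI; apply/negP => /andP[/(Nanc _ _ y1R)[x1 E1] /(Nanc _ _ y2R)[x2 E2]].
  have [|s si sx] := @dist_ancestor T e con v x i; first by lia.
  by apply: (dis s si); [apply: ancestor_up x1 _ si _ | apply: ancestor_up x2 _ si _].
have [iE|iN] := eqVneq i R.-2.
  have sub : N y1 :|: N y2 \subset S.
    apply/subsetP => x; rewrite in_setU.
    have xS z : L z = R.-1 -> i < L z -> x \in N z -> x \in S.
      move=> zR iz /(Nanc _ _ zR)[xz E]; have xi : L x = i by lia.
      by apply: (anc z) => //; apply: (ancestor_up xz E xi); rewrite distxx xi.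
    by case/orP; apply: xS.
  by have := subset_leq_card sub; lia.
have sub : N y1 :|: N y2 \subset level R.-2.
  by apply/subsetP => x; rewrite !inE => /orP[] /andP[].
by have := subset_leq_card sub; rewrite n3; lia.
Qed.

End LevelSizes.

(** * Sums of distances *)

Lemma sum_interval n a b : a <= b <= n ->
  2 * (\sum_(i < n) i * (a <= i < b)) + a * a + b = b * b + a.
Proof.
elim: n b => [|n IHn] b abn.
  by rewrite big_ord0; have [-> ->] : a = 0 /\ b = 0 by lia.
rewrite big_ord_recr /=; have [bn|nb] : b <= n \/ b = n.+1 by lia.
  have -> : (a <= n < b) = false by lia.
  by rewrite muln0 addn0 IHn //; lia.
have [an|na] : a <= n \/ a = b by lia.
  have -> : (a <= n < b) = true by lia.
  rewrite (eq_bigr (fun i : 'I_n => i * (a <= i < n))) => [|i _].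
    have := IHn n; rewrite an leqnn nb muln1 => /(_ isT).
    by move: (\sum_(_ < _) _) => S; nia.
  by have := ltn_ord i; rewrite nb ltnS => /[dup] /ltnW -> ->.
rewrite big1 => [|i _]; first by rewrite na; lia.
have -> : (a <= i < b) = false by have := ltn_ord i; lia.
exact: muln0.
Qed.

Section Sums.

Variables (T : finType) (e : rel T) (v : T).
Hypothesis quad : quadrangulation e.

Notation L := (dist e v).
Notation r := (radius e).
Notation R := (ecc e v).
Notation level := (level e v).
Notation sigma := (\sum_(w : T) dist e v w).

Lemma sum_dist_levels : sigma = \sum_(i < R.+1) i * #|level i|.
Proof.
transitivity (\sum_(w : T) \sum_(i < R.+1) i * (L w == i)).
  apply: eq_bigr => w _.
  have wR : L w < R.+1 by rewrite ltnS ecc_ub.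
  rewrite (bigD1 (Ordinal wR)) //= eqxx muln1 big1 ?addn0 // => i.
  by rewrite -val_eqE /= eq_sym => /negPf ->; rewrite muln0.
rewrite exchange_big; apply: eq_bigr => i _.
rewrite -big_distrr /=; congr (_ * _); rewrite -sum1_card [RHS]big_mkcond.
by apply: eq_bigr => w _; rewrite inE; case: eqP.
Qed.

(* [2 * \sum_(a <= i < b) i = (b * b - b) - (a * a - a)], with the negative
   terms moved to the other side *)
Lemma sum_dist_ge (l : seq (nat * nat)) c :
  all (fun ab => ab.1 <= ab.2 <= R.+1) l ->
  (forall i, 0 < i < R -> \sum_(ab <- l) (ab.1 <= i < ab.2) <= #|level i|) ->
  \sum_(ab <- l) (ab.1 <= R < ab.2) <= #|level R| + c ->
  \sum_(ab <- l) (ab.2 * ab.2 + ab.1)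
    <= 2 * (sigma + R * c) + \sum_(ab <- l) (ab.1 * ab.1 + ab.2).
Proof.
move=> /allP lR li lc.
rewrite (eq_big_seq (fun ab => 2 * (\sum_(i < R.+1) i * (ab.1 <= i < ab.2))
  + (ab.1 * ab.1 + ab.2))) => [|ab /lR abR]; last by rewrite addnA sum_interval.
rewrite big_split -big_distrr leq_add2r leq_mul2l exchange_big /=.
rewrite sum_dist_levels !big_ord_recr /= -addnA -mulnDr.
apply: leq_add; last by rewrite -big_distrr leq_mul2l lc orbT.
apply: leq_sum => -[[|i] iR] _; first by rewrite big1.
by rewrite -big_distrr leq_mul2l li ?orbT.
Qed.

Lemma level_ecc_gt0 : 0 < #|level R|.
Proof.
have [y yR] := ecc_witness e v; apply/card_gt0P; exists y.
by rewrite inE yR.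
Qed.

Lemma sum_dist_ge2 : 2 * r ^ 2 <= sigma + 6 * r.
Proof.
have rR := radius_le_ecc e v; have con2 : k_connected 2 e by case: quad.
have n2 := level_card quad (isT : 0 < 2) con2; have nR := level_ecc_gt0.
have [X RE] : exists X, R = r + X by exists (R - r); lia.
have [gen|triv] := leqP (2 * R + 7) (3 * r).
  have [w rE] : exists w, r = 2 * X + 7 + w by exists (r - (2 * X + 7)); lia.
  (* Each interval counts one vertex per level: two throughout, a third where [level2_ge3] applies,
     a fourth where [level2_ge4] does. The deficit 1 allows for a single vertex in level [R]. *)
  pose l := [:: (0, R.+1); (0, R.+1); (X + 2, X + w + 6); (X + 3, X + w + 4)].
  unshelve epose proof (@sum_dist_ge l 1 _ _ _) as sge.
  - by rewrite /=; lia.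
  - move=> i iR; have := n2 v i iR; have := @level2_ge3 _ _ v quad i.
    by have := @level2_ge4 _ _ v quad i; rewrite !big_cons big_nil /=; lia.
  - by rewrite !big_cons big_nil /=; lia.
  move: sge; rewrite !big_cons !big_nil /= RE rE; move: sigma => S.
  by rewrite !mulnn; nia.
(* Levels of size 2 suffice here, since [2 * R >= 3 * r - 6]. *)
pose l := [:: (0, R.+1); (0, R.+1)].
unshelve epose proof (@sum_dist_ge l 1 _ _ _) as sge.
- by rewrite /=; lia.
- by move=> i iR; have := n2 v i iR; rewrite !big_cons big_nil /=; lia.
- by rewrite !big_cons big_nil /=; lia.
have rX : r <= 2 * X + 6 by lia.
move: sge; rewrite !big_cons !big_nil /= RE; move: sigma (r) rX => S r' rX.
by nia.
Qed.

(** The general bounds on level sizes can fall slightly short. Either level [R - 1] is large, or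
    levels [2 r - R - 3] and [2 r - R - 2] have an extra vertex each, and a further one is found in
    level [R] or between. *)
Lemma sum_dist_ge3 : k_connected 3 e -> 3 * r ^ 2 <= sigma + 9 * r.
Proof.
move=> con3; have rR := radius_le_ecc e v.
have n3 := @level_card _ _ _ v quad (isT : 0 < 3) con3; have nR := level_ecc_gt0.
have [X RE] : exists X, R = r + X by exists (R - r); lia.
pose base := [:: (0, R.+1); (0, R.+1); (0, R.+1)].
have [mid|triv] := leqP (2 * X + 6) r; last first.
  unshelve epose proof (@sum_dist_ge base 2 _ _ _) as sge.
  - by rewrite /=; lia.
  - by move=> i iR; have := n3 i iR; rewrite !big_cons big_nil /=; lia.
  - by rewrite !big_cons big_nil /=; lia.
  move: sge; rewrite !big_cons !big_nil /= RE; move: sigma (r) triv => S r' triv.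
  by nia.
pose tops := [:: (R.-1, R); (R.-1, R); (R.-1, R)].
have [gen|small] := leqP (2 * X + 7) r; last first.
  have rE : r = 2 * X + 6 by lia.
  (* Here [X + 4] is [2 r - R - 2]. *)
  have [n_i0|n_i0] := eqVneq #|level (X + 4)| 3.
    have [|||nR2 nR6] := @level3_eq3_tops _ _ v quad con3 (X + 4); try lia.
    unshelve epose proof (@sum_dist_ge (tops ++ base) 1 _ _ _) as sge.
    - by rewrite /=; lia.
    - move=> i iR; have := n3 i iR; rewrite !big_cons big_nil /=.
      by have [->|] := eqVneq i R.-1; lia.
    - by rewrite !big_cons big_nil /=; lia.
    move: sge; rewrite !big_cons !big_nil /= RE rE; move: sigma => S.
    by nia.
  unshelve epose proof (@sum_dist_ge ((X + 4, X + 5) :: base) 2 _ _ _) as sge.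
  - by rewrite /=; lia.
  - move=> i iR; have := n3 i iR; rewrite !big_cons big_nil /=.
    by have [->|] := eqVneq i (X + 4); lia.
  - by rewrite !big_cons big_nil /=; lia.
  move: sge; rewrite !big_cons !big_nil /= RE rE; move: sigma => S.
  by nia.
have [w rE] : exists w, r = 2 * X + 7 + w by exists (r - (2 * X + 7)); lia.
have RwE : R = 3 * X + w + 7 by lia.
have R1E : R.-1 = 3 * X + w + 6 by lia.
(* Truncated, so that the third interval of [mids] is empty rather than ill-formed when [w < 2]. *)
have [u uE] : exists u, u = w - 2 by exists (w - 2).
have {}uE : w = 0 /\ u = 0 \/ w = 1 /\ u = 0 \/ w = u + 2 by lia.
pose mids := [:: (X + 3, X + w + 5); (X + 4, X + w + 4); (X + 5, X + 5 + u)] ++ base.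
pose size_bound i := (X + 3 <= i < X + w + 5) + (X + 4 <= i < X + w + 4)
  + (X + 5 <= i < X + 5 + u) + 3.
have midsE i : i <= R -> \sum_(ab <- mids) (ab.1 <= i < ab.2) = size_bound i.
  by move=> iR; rewrite !big_cons big_nil /= /size_bound; lia.
have n_i i : 0 < i < R -> size_bound i <= #|level i|.
  move=> iR; rewrite /size_bound; have := n3 i iR.
  have := @level3_ge4 _ _ v quad con3 i; have := @level3_ge5 _ _ v quad con3 i.
  by have := @level3_ge6 _ _ v quad con3 i; lia.
have mids_ok : all (fun ab => ab.1 <= ab.2 <= R.+1) mids by rewrite /=; lia.
have size_R : size_bound R = 3 by rewrite /size_bound; lia.
have with_tops : 2 <= #|level R| /\ 6 <= #|level R.-1| -> 3 * r ^ 2 <= sigma + 9 * r.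
  move=> [nR2 nR6].
  unshelve epose proof (@sum_dist_ge (tops ++ mids) 1 _ _ _) as sge.
  - by rewrite all_cat mids_ok /=; lia.
  - move=> i iR; rewrite big_cat midsE; last by lia.
    rewrite !big_cons big_nil /=; have := n_i i iR; rewrite /size_bound.
    by have [->|] := eqVneq i R.-1; lia.
  - by rewrite big_cat midsE // size_R !big_cons big_nil /=; lia.
  move: sge; rewrite !big_cons !big_nil /= R1E RwE rE; move: sigma => S.
  by clear - uE; case: uE => [[-> ->]|[[-> ->]|->]]; nia.
(* Levels [X + w + 5] and [X + w + 4] are [2 r - R - 2] and [2 r - R - 3]. *)
have [n_i0|n_i0] := eqVneq #|level (X + w + 5)| 3.
  by apply: with_tops; apply: (level3_eq3_tops quad con3 _ _ n_i0); lia.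
have [n_i1|n_i1] := eqVneq #|level (X + w + 4)| 4.
  by apply: with_tops; apply: (level3_eq4_tops quad con3 _ _ n_i1); lia.
have n_i0' : 4 <= #|level (X + w + 5)| by have := n3 (X + w + 5); lia.
have n_i1' : 5 <= #|level (X + w + 4)|.
  by have := n_i (X + w + 4); rewrite /size_bound; lia.
pose e1 := [:: (X + w + 5, X + w + 6); (X + w + 4, X + w + 5)].
have pointwise i : 0 < i < R ->
    (X + w + 5 <= i < X + w + 6) + (X + w + 4 <= i < X + w + 5) + size_bound i
      <= #|level i|.
  move=> iR; have := n_i i iR; rewrite /size_bound.
  have [->|i0] := eqVneq i (X + w + 5); first by lia.
  have [->|i1] := eqVneq i (X + w + 4); first by lia.
  have -> : (X + w + 5 <= i < X + w + 6) = false by lia.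
  by have -> : (X + w + 4 <= i < X + w + 5) = false by lia.
have [nR2|nR1] := leqP 2 #|level R|.
  unshelve epose proof (@sum_dist_ge (e1 ++ mids) 1 _ _ _) as sge.
  - by rewrite all_cat mids_ok /=; lia.
  - move=> i iR; rewrite big_cat midsE; last by lia.
    by rewrite !big_cons big_nil /=; have := pointwise i iR; lia.
  - by rewrite big_cat midsE // size_R !big_cons big_nil /=; lia.
  move: sge; rewrite !big_cons !big_nil /= RwE rE; move: sigma => S.
  by clear - uE; case: uE => [[-> ->]|[[-> ->]|->]]; nia.
(* Level [R] has a single vertex, a deficit of 2; one more vertex in level [t] makes up for it. *)
have extra t : X + w + 5 <= t < R -> #|level t| != 3 -> (t = X + w + 5 -> #|level t| != 4) ->
    3 * r ^ 2 <= sigma + 9 * r.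
  move=> tR nt nt'.
  unshelve epose proof (@sum_dist_ge ((t, t.+1) :: e1 ++ mids) 2 _ _ _) as sge.
  - by rewrite /=; lia.
  - move=> i iR; rewrite big_cons big_cat midsE; last by lia.
    rewrite !big_cons big_nil /=; have := pointwise i iR; have := n3 i iR.
    have [->|it] := eqVneq i t; last first.
      have -> : (t <= i < t.+1) = false by lia.
      by move: (size_bound i) => b; lia.
    have -> : size_bound t = 3 by rewrite /size_bound; lia.
    by have [t0|t0] := eqVneq t (X + w + 5); [have := nt' t0 | ]; lia.
  - by rewrite big_cons big_cat midsE // size_R !big_cons big_nil /=; lia.
  move: sge tR; rewrite !big_cons !big_nil /= RwE rE; move: sigma => S.
  by clear - uE; case: uE => [[-> ->]|[[-> ->]|->]]; nia.
have [n4|n4] := eqVneq #|level (X + w + 5)| 4; last by apply: (extra (X + w + 5)) => //; lia.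
have [all3|/forallPn[t]] := boolP [forall t : 'I_R, (X + w + 5 < t) ==> (#|level t| == 3)].
  have [] := @level3_eq4_above _ _ v quad con3 (X + w + 5) _ _ n4 _; try lia.
  move=> t /andP[t0 tR]; have /forallP/(_ (Ordinal tR)) := all3.
  by rewrite /= t0 => /eqP.
by rewrite negb_imply => /andP[t0 nt]; apply: (extra t) => //; have := ltn_ord t; lia.
Qed.

End Sums.

(** * From sums of distances to radius and proximity *)

Local Open Scope ring_scope.

Lemma proximity_ge (T : finType) (e : rel T) (b : rat) : (0 < #|T|)%N ->
  (forall v, b <= avg_dist e v) -> b <= proximity e.
Proof.
move=> /card_gt0P[v0 _] bv; rewrite /proximity; elim/big_ind: _ => //.
  (* The default value of the minimum is the remoteness, at least [avg_dist e v0]. *)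
  apply: le_trans (bv v0) _; rewrite /remoteness.
  exact: (le_bigmax _ (avg_dist e) v0).
by move=> x y bx b_y; rewrite le_min bx.
Qed.

Lemma gap_le (k r sig N : rat) : 0 < k -> 0 < N ->
  k * r ^+ 2 <= sig + 3 * k * r ->
  r - sig / N <= (N + 6 * k) / (4 * k) + 9 * k / (4 * N).
Proof.
move=> k_gt0 N_gt0 sig_ge; rewrite -subr_ge0.
have -> : (N + 6 * k) / (4 * k) + 9 * k / (4 * N) - (r - sig / N)
    = ((N + 3 * k - 2 * k * r) ^+ 2 + 4 * k * (sig + 3 * k * r - k * r ^+ 2))
      / (4 * k * N).
  by field; rewrite !gt_eqF.
apply: divr_ge0; last by rewrite !mulr_ge0 // ltW.
by rewrite addr_ge0 ?sqr_ge0 // !mulr_ge0 ?subr_ge0 // ltW.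
Qed.

Theorem theorem4p3 (T : finType) (e : rel T) :
  (quadrangulation e ->
     (radius e)%:R - proximity e
       <= (#|T|%:R + 11) / 8 + 9 / (2 * (#|T|%:R - 1)) :> rat)
  /\
  (quadrangulation e -> k_connected 3 e ->
     (radius e)%:R - proximity e
       <= (#|T|%:R + 17) / 12 + 27 / (4 * (#|T|%:R - 1)) :> rat).
Proof.
have N_gt0 : quadrangulation e -> 0 < #|T|%:R - 1 :> rat.
  by case=> _ [T_gt2 _] _ _ _; rewrite subr_gt0 ltr1n ltnW.
(* With [n = #|T|], the first fraction is [(n + 11) / 8] for [k = 2] and [(n + 17) / 12] for
   [k = 3]. *)
have gap k : (0 < k)%N -> quadrangulation e ->
    (forall v, k * radius e ^ 2 <= \sum_w dist e v w + 3 * k * radius e)%N ->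
    (radius e)%:R - proximity e <= (#|T|%:R - 1 + 6 * k%:R) / (4 * k%:R)
      + 9 * k%:R / (4 * (#|T|%:R - 1)) :> rat.
  move=> k_gt0 quad sig; rewrite lerBlDr -lerBlDl; apply: proximity_ge => [|v].
    by case: quad => _ [T_gt2 _] _ _ _; lia.
  rewrite lerBlDl -lerBlDr; apply: gap_le; rewrite ?ltr0n ?N_gt0 //.
  by rewrite -!natrX -!natrM -natrD ler_nat sig.
have two (x : rat) : x != 0 -> 9 * 2 / (4 * x) = 9 / (2 * x) by move=> x0; field.
split=> [quad|quad con3].
  have N0 : #|T|%:R - 1 != 0 :> rat by rewrite gt_eqF ?N_gt0.
  have := gap 2 isT quad (fun v => sum_dist_ge2 v quad).
  by rewrite two //; lra.
have N0 : #|T|%:R - 1 != 0 :> rat by rewrite gt_eqF ?N_gt0.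
have := gap 3 isT quad (fun v => sum_dist_ge3 v quad con3).
have -> : 9 * 3%:R = 27 :> rat by lra.
by lra.
Qed.
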